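(* Let $G$ be a group with a malnormal subgroup $A$ such that $A$ contains no involutions. Assume further that $G$ is not sharply $2$-transitive on the set of right cosets $A\backslash G$. Then $G$ is contained (as a subgroup) in a group $\mathcal{G}$ having a malnormal subgroup $\mathcal{A}$ such that (1) $\mathcal{A}\cap G=A$; (2) $\mathcal{G}$ is sharply $2$-transitive on the set of right cosets $X:=\mathcal{A}\backslash\mathcal{G}$; (3) $\mathcal{A}$ contains no involutions (i.e. $\mathcal{G}$ is of permutational characteristic $2$); (4) $\mathcal{G}$ does not contain a non-trivial abelian normal subgroup; (5) if $G$ is infinite then $G$ and $\mathcal{G}$ have the same cardinality, and similarly $X$ and $A\backslash G$ have the same cardinality.
   Context: A proper subgroup $A$ of a group $G$ is called malnormal in $G$ if $A\cap g^{-1}Ag=1$ for all $g\in G\setminus A$. An involution is an element of order exactly $2$. $A\backslash G$ is the set of right cosets $Ag$, on which $G$ acts by right multiplication. A group $G$ acting on a set $X$ is sharply $2$-transitive on $X$ if $G$ is transitive on $X$ and for any two ordered pairs $(x_1,x_2),(x_1',x_2')\in X\times X$ of distinct points (i.e. $x_1\ne x_2$, $x_1'\neq x_2'$) there exists a unique $g\in G$ with $x_ig=x_i'$ for $i=1,2$. A sharply $2$-transitive group on $X$ is said to have (permutational) characteristic $2$ if its involutions have no fixed points in $X$. *)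

(* Defs.v *)
From HB Require Import structures.
From mathcomp Require Import all_boot.
From mathcomp Require Import boolp classical_sets functions cardinality.

Set Implicit Arguments.
Unset Strict Implicit.
Unset Printing Implicit Defensive.

Local Open Scope classical_set_scope.
Local Open Scope group_scope.

Definition subgroup (G : groupType) (A : set G) : Prop := group_closed (mem A).

Lemma subgroupP (G : groupType) (A : set G) :
  subgroup A <-> [/\ A 1, forall x y, A x -> A y -> A (x * y)
                     & forall x, A x -> A x^-1].
Proof.
split.
- move=> [A1 AF]; have {}A1 : A 1 by move: A1; rewrite inE.
  have {}AF x y : A x -> A y -> A (x / y).
    by move=> Ax Ay; have := AF x y; rewrite !inE; apply.
  have AV x : A x -> A x^-1 by move=> Ax; rewrite -[x^-1]mul1g; apply: AF.
  by split=> // x y Ax Ay; rewrite -[y]invgK; apply: AF => //; apply: AV.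
- move=> [A1 AM AV]; split; first by rewrite inE.
  by move=> x y; rewrite !inE => Ax Ay; apply: AM => //; apply: AV.
Qed.

(* [x ^ g] is [g^-1 * (x * g)], so the image below is the conjugate g^-1 A g. *)
Definition malnormal (G : groupType) (A : set G) : Prop :=
  [/\ subgroup A, A <> [set: G]
    & forall g, ~ A g -> A `&` [set x ^ g | x in A] = [set 1]].

Definition involution (G : groupType) (t : G) : Prop := t <> 1 /\ t ^+ 2 = 1.

Definition normal (G : groupType) (N : set G) : Prop :=
  subgroup N /\ forall x g, N x -> N (x ^ g).

Definition abelian (G : groupType) (N : set G) : Prop :=
  forall x y, N x -> N y -> commute x y.

Record right_action (G : groupType) (T : Type) (X : set T) := RightAction {
  act :> T -> G -> T;
  act_closed : forall x g, X x -> X (act x g);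
  act1 : forall x, X x -> act x 1 = x;
  actM : forall x g h, X x -> act x (g * h) = act (act x g) h
}.

Definition sharply_2_transitive (G : groupType) (T : Type) (X : set T)
    (to : right_action G X) : Prop :=
  (forall x y, X x -> X y -> exists g, to x g = y) /\
  (forall x1 x2 x1' x2', X x1 -> X x2 -> X x1' -> X x2' ->
     x1 <> x2 -> x1' <> x2' ->
     exists! g, to x1 g = x1' /\ to x2 g = x2').

Definition perm_char_2 (G : groupType) (T : Type) (X : set T)
    (to : right_action G X) : Prop :=
  forall t, involution t -> forall x, X x -> to x t <> x.

Definition rcoset (G : groupType) (A : set G) (g : G) : set G :=
  [set x * g | x in A].

Definition rcosets (G : groupType) (A : set G) : set (set G) :=
  range (rcoset A).

Lemma rcoset1 (G : groupType) (A : set G) : rcoset A 1 = A.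
Proof.
by apply/seteqP; split=> [_ [x Ax <-]|x Ax]; [rewrite mulg1|exists x; rewrite ?mulg1].
Qed.

Lemma rcosetM (G : groupType) (A : set G) (g h : G) :
  rcoset A (g * h) = rcoset (rcoset A g) h.
Proof.
apply/seteqP; split=> [_ [x Ax <-]|_ [_ [x Ax <-] <-]].
- by exists (x * g); [exists x|rewrite mulgA].
- by exists x => //; rewrite mulgA.
Qed.

Lemma rcosets_closed (G : groupType) (A C : set G) (g : G) :
  rcosets A C -> rcosets A (rcoset C g).
Proof. by move=> [h _ <-]; exists (h * g) => //; rewrite rcosetM. Qed.

(* Right multiplication sends the coset C = A h to C g = A h g. *)
Definition coset_action (G : groupType) (A : set G) :
    right_action G (rcosets A) :=
  RightAction (act := fun C g => rcoset C g)
    (fun C g => @rcosets_closed G A C g)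
    (fun C _ => rcoset1 C)
    (fun C g h _ => rcosetM C g h).

(* Main.v *)
Require Import Defs.
From HB Require Import structures.
From mathcomp Require Import all_boot.
From mathcomp Require Import boolp classical_sets functions cardinality.

Set Implicit Arguments.
Unset Strict Implicit.
Unset Printing Implicit Defensive.

Local Open Scope classical_set_scope.
Local Open Scope card_scope.
Local Open Scope group_scope.

(** The group [G] acts on the cosets of [A].  Malnormality of [A] says that a
    nontrivial element fixes at most one coset, and [A] having no involution
    says that involutions fix no coset.  Such an action is sharply
    2-transitive as soon as there is an involution [t] and, for every [u]
    outside [A], some [f] with [f] in [A] and [t f] in [A u]: then [f] carries
    the pair [(A, A t)] to [(A, A u)], so every pair of cosets is reached from
    one fixed pair.  The proof adjoins such elements [f] for all [u] at once,
    keeping the two properties of the action, and repeats this countably often.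

    Two orbits of pairs can be merged by a new letter [f] only if their
    stabilisers agree as groups of permutations of the pair.  The pair
    [(A, A t)] is swapped by the involution [t].  If [(A, A u)] is swapped by
    some element of [G], then, after replacing [u] by another element of [A u A],
    the swap is an involution [u], and one adjoins a stable letter of an HNN
    extension with [t f = f u].  Otherwise the letter is free.  One letter is
    needed for each class of [u] modulo double cosets and inversion
    ([move_pairs]).

    The heart is [free_extension].  It treats at once stable letters, free
    letters and letters of order 2: the letters come with an involution [bar]
    for inversion, with elements [s l] of order at most 2 satisfying
    [s l * l = l * s (bar l)], and with the values that they must take on
    certain subsets of the given set [X].  The action is completed freely:
    every value that is not prescribed becomes a new point, so that the new
    points form a tree growing out of [X].  A reduced word that has once left
    towards the leaves can never come back ([push_path]).  This gives both
    Britton's lemma ([value_neq1]) and the control of fixed points: up to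
    conjugation an element lies in [G], or is a word of length one with a
    self-inverse letter, or is a cyclically reduced word ([cyclic_form]), and a
    cyclically reduced word that fixes a point only uses prescribed values in
    [X] ([cycle_fix]).  For two distinct fixed points this would be a closed
    reduced path in the graph whose vertices are the orbits of pairs and whose
    edges are the letters.  That graph is a star with
    centre the orbit of [(A, A t)], so there is none ([cycle_fix_unique]).

    An initial step adjoins an involution ([adjoin_involution]).  Each step also
    adjoins a letter [c] satisfying no relation, so that [n] and [n ^ c] do not
    commute for [n <> 1]; in the union no nontrivial element commutes with all
    its conjugates, and no nontrivial normal subgroup is abelian
    ([no_abelian_normal]).  The group of a step is an image of the words over
    an alphabet no larger than the previous group, so an infinite cardinality is
    preserved, by the equality of an infinite cardinal with its square
    ([infinite_square]).  The same equality shows that a malnormal subgroup of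
    an infinite group has as many cosets as the group has elements
    ([card_rcosets]). *)

(** * Quotients by congruences *)

(** Choosing from the class as a set, which is the same set for equivalent
    elements by extensionality, makes the choice constant on classes. *)
Lemma class_representatives (T : Type) (R : T -> T -> Prop) :
    (forall x, R x x) -> (forall x y, R x y -> R y x) ->
    (forall x y z, R x y -> R y z -> R x z) ->
  exists c : T -> T, forall x, R x (c x) /\ forall y, R x y -> c x = c y.
Proof.
move=> Rxx Rsym Rtrans.
exists (fun x => sval (cid (ex_intro (R x) x (Rxx x)))) => x; split=> [|y Rxy].
  by case: cid.
have E : R x = R y.
  by apply/funext => z; apply/propext; split; apply: Rtrans => //; apply: Rsym.
by move: (ex_intro (R x) x (Rxx x)); rewrite E => p; congr (sval (cid _));
  apply: Prop_irrelevance.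
Qed.

(** The group laws are only required up to the congruence [R].  This yields the
    group generated by letters, whose words satisfy the laws modulo their action,
    and direct limits, whose sequences satisfy them eventually. *)
Section QuotientGroup.
Variables (P : Type) (R : P -> P -> Prop).
Variables (one : P) (inv : P -> P) (mul : P -> P -> P).
Hypothesis Rxx : forall x, R x x.
Hypothesis Rsym : forall x y, R x y -> R y x.
Hypothesis Rtrans : forall x y z, R x y -> R y z -> R x z.
Hypothesis Rmul : forall x x' y y', R x x' -> R y y' -> R (mul x y) (mul x' y').
Hypothesis RmulA : forall x y z, R (mul x (mul y z)) (mul (mul x y) z).
Hypothesis Rmul1 : forall x, R (mul one x) x /\ R (mul x one) x.
Hypothesis RmulV : forall x, R (mul (inv x) x) one /\ R (mul x (inv x)) one.

Let canon : P -> P := sval (cid (class_representatives Rxx Rsym Rtrans)).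

Let canonP x : R x (canon x).
Proof. by rewrite /canon; case: cid => c /= /(_ x)[]. Qed.

Let canon_eq x y : R x y -> canon x = canon y.
Proof. by rewrite /canon; case: cid => c /= /(_ x)[_]; apply. Qed.

Let Q := {x : P | canon x = x}.

Let canonK x : canon (canon x) = canon x.
Proof. by apply/canon_eq/Rsym/canonP. Qed.

Let pi (x : P) : Q := exist _ (canon x) (canonK x).

Let pi_val (q : Q) : pi (sval q) = q.
Proof. by case: q => x e; apply: eq_exist. Qed.

Let piE x y : pi x = pi y <-> R x y.
Proof.
split=> [[E]|Rxy]; last by apply/eq_exist/canon_eq.
by apply: Rtrans (canonP x) _; rewrite E; apply/Rsym/canonP.
Qed.

Let Qmul (p q : Q) : Q := pi (mul (sval p) (sval q)).

Let pi_mul x y : pi (mul x y) = Qmul (pi x) (pi y).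
Proof. by apply/piE/Rmul; apply: canonP. Qed.

Let QmulA : associative Qmul.
Proof.
move=> p q r; rewrite -(pi_val p) -(pi_val q) -(pi_val r) -!pi_mul.
exact/piE.
Qed.
Let Qmul1l : left_id (pi one) Qmul.
Proof. by move=> p; rewrite -(pi_val p) -!pi_mul; apply/piE; case: (Rmul1 (sval p)). Qed.
Let Qmul1r : right_id (pi one) Qmul.
Proof. by move=> p; rewrite -(pi_val p) -!pi_mul; apply/piE; case: (Rmul1 (sval p)). Qed.
Let Qinv (p : Q) : Q := pi (inv (sval p)).
Let QmulVl : left_inverse (pi one) Qinv Qmul.
Proof. by move=> p; rewrite -{2}(pi_val p) -!pi_mul; apply/piE; case: (RmulV (sval p)). Qed.
Let QmulVr : right_inverse (pi one) Qinv Qmul.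
Proof. by move=> p; rewrite -{1}(pi_val p) -!pi_mul; apply/piE; case: (RmulV (sval p)). Qed.

Lemma quotient_group : exists (Q : groupType) (pi : P -> Q),
  [/\ forall q, exists x, pi x = q, forall x y, pi x = pi y <-> R x y
    & forall x y, pi (mul x y) = pi x * pi y].
Proof.
pose QC : choiceType := HB.pack Q (gen_eqMixin Q) (gen_choiceMixin Q).
pose QG : groupType := HB.pack QC (isGroup.Build QC QmulA Qmul1l Qmul1r QmulVl QmulVr).
exists QG, pi; split=> //.
by move=> q; exists (sval q); apply: pi_val.
Qed.
End QuotientGroup.

(** * The free completion of a partial action *)

(** The subgroup [{1, t}], when [t * t = 1]. *)
Definition assoc_sub (G : groupType) (t h : G) : Prop := h = 1 \/ h = t.

(** [L] is a set of letters to be adjoined to [G], with inversion [bar].  The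
    letter [l] shall satisfy [s l * l = l * s (bar l)], and send [x] in [D l]
    to [phi l x].  The hypothesis [D_pairs] describes the graph formed
    by the orbits of pairs of points, with an edge for every letter defined on
    two points.  Letters [l] and [l'] may leave the same orbit in two ways: they
    are equal, and only elements of [{1, s l}] preserve the pair, or both
    belong to [out], the edges directed away from one central orbit.  So this
    graph is a star.  The letter [c] is free. *)
Section Completion.
Variables (G : groupType) (X : Type) (op : X -> G -> X).
Hypothesis op1 : forall x, op x 1 = x.
Hypothesis opM : forall x g h, op x (g * h) = op (op x g) h.
Hypothesis op_inv : forall x g, g * g = 1 -> g <> 1 -> op x g <> x.
Hypothesis op_two : forall x y g, x <> y -> op x g = x -> op y g = y -> g = 1.
Variables (L : Type) (bar : L -> L) (s : L -> G).
Hypothesis barK : involutive bar.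
Hypothesis s_sq : forall l, s l * s l = 1.
Hypothesis s_bar : forall l, s l = 1 -> s (bar l) = 1.
Variables (D : L -> X -> Prop) (phi : L -> X -> X).
Hypothesis D_phi : forall l x, D l x -> D (bar l) (phi l x).
Hypothesis phiK : forall l x, D l x -> phi (bar l) (phi l x) = x.
Hypothesis D_s : forall l x, D l x -> D l (op x (s l)).
Hypothesis phi_s : forall l x,
  D l x -> phi l (op x (s l)) = op (phi l x) (s (bar l)).
Hypothesis D_self : forall l x, bar l = l -> ~ D l x.
Variable (out : L -> Prop).
Hypothesis out_bar : forall l, out l -> ~ out (bar l).
Hypothesis D_pairs : forall l l' x y g, x <> y ->
  D l x -> D l y -> D l' (op x g) -> D l' (op y g) ->
  (l' = l /\ assoc_sub (s l) g) \/ (out l /\ out l').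
Variables (c : L) (x0 : X).
Hypothesis c_bar : bar c <> c.
Hypothesis s_c : s c = 1.
Hypothesis D_c : forall x, ~ D c x /\ ~ D (bar c) x.

(** [Node z l g] stands for the image of [z] under [l] and then [g], where no
    value of [l] at [z] was prescribed. *)
Inductive point := Base of X | Node of point & L & G.

Definition pact (z : point) (g : G) : point :=
  match z with Base x => Base (op x g) | Node z' l h => Node z' l (h * g) end.

Lemma pact1 z : pact z 1 = z.
Proof. by case: z => [x|z l h] /=; rewrite ?op1 ?mulg1. Qed.

Lemma pactM z g h : pact z (g * h) = pact (pact z g) h.
Proof. by case: z => [x|z l k] /=; rewrite ?opM ?mulgA. Qed.

Local Notation assoc l := (assoc_sub (s l)).

Lemma assoc_s l : assoc l (s l). Proof. by right. Qed.
Lemma assocM l g h : assoc l g -> assoc l h -> assoc l (g * h).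
Proof.
by move=> [->|->] [->|->]; rewrite ?mul1g ?mulg1 ?s_sq; [left|right|right|left].
Qed.

Lemma assocV l g : assoc l g -> g^-1 = g.
Proof. by move=> [->|->]; [exact: invg1|apply: mulg1_eq]. Qed.

Lemma assocMl l g h : assoc l g -> assoc l (g * h) <-> assoc l h.
Proof.
move=> Sg; split=> Sh; last exact: assocM.
by rewrite -(mulKg g h) (assocV Sg); apply: assocM.
Qed.

(** The isomorphism [{1, s l} -> {1, s (bar l)}] by which elements are moved
    across the letter [l]. *)
Definition twist (l : L) (h : G) : G := if h == 1 then 1 else s (bar l).

Lemma assoc_twist l h : assoc (bar l) (twist l h).
Proof. by rewrite /twist; case: eqP => _; [left|right]. Qed.

Lemma twist1 l : twist l 1 = 1. Proof. by rewrite /twist eqxx. Qed.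

Lemma twist_s l : twist l (s l) = s (bar l).
Proof. by rewrite /twist; case: eqP => // /s_bar ->. Qed.

Lemma twistK l h : assoc l h -> twist (bar l) (twist l h) = h.
Proof. by move=> [->|->]; rewrite ?twist1 ?twist_s ?barK. Qed.

Lemma twistM l g h :
  assoc l g -> assoc l h -> twist l (g * h) = twist l g * twist l h.
Proof.
by move=> [->|->] [->|->]; rewrite ?mul1g ?mulg1 ?s_sq ?twist1 ?twist_s ?s_sq ?mul1g ?mulg1.
Qed.

Lemma pact_s_free z l : s l <> 1 -> pact z (s l) <> z.
Proof.
case: z => [x|z l' h] s1 /= [].
  by apply: op_inv => //; apply: s_sq.
by rewrite -[in RHS](mulg1 h) => /mulgI.
Qed.

Let orbR l z z' := z' = z \/ z' = pact z (s l).

Let rep_exists l : exists r : point -> point,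
  forall z, orbR l z (r z) /\ forall z', orbR l z z' -> r z = r z'.
Proof.
apply: class_representatives => [z|z z'|z1 z2 z3]; first by left.
  by move=> [->|->]; [left|right; rewrite -pactM s_sq pact1].
by move=> [->|->] [->|->]; rewrite -?pactM ?s_sq ?pact1; [left|right|right|left];
  rewrite -?pactM ?s_sq ?pact1.
Qed.

(** Since [s l] moves across [l], the points [z] and [z (s l)] must give nodes
    in the same [G]-orbit; only one of the two is used to build a node, and [off l z]
    is the element of [{1, s l}] leading from it to [z]. *)
Definition rep l : point -> point := sval (cid (rep_exists l)).

Lemma repP l z : rep l z = z \/ rep l z = pact z (s l).
Proof. by rewrite /rep; case: cid => r /= /(_ z)[]. Qed.

Lemma rep_s l z : rep l (pact z (s l)) = rep l z.
Proof. by rewrite /rep; case: cid => r /= /(_ z)[_] <- //; right. Qed.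

Lemma rep_assoc l z h : assoc l h -> rep l (pact z h) = rep l z.
Proof. by move=> [->|->]; rewrite ?pact1 ?rep_s. Qed.

Lemma rep_rep l z : rep l (rep l z) = rep l z.
Proof. by case: (repP l z) => {1}->; rewrite ?rep_s. Qed.

Definition off l z : G := if `[< rep l z = z >] then 1 else s l.

Lemma assoc_off l z : assoc l (off l z).
Proof. by rewrite /off; case: ifP => _; [left|right]. Qed.

Lemma off_rep l z : pact (rep l z) (off l z) = z.
Proof.
rewrite /off; case: asboolP => [->|]; first exact: pact1.
by case: (repP l z) => // -> _; rewrite -pactM s_sq pact1.
Qed.

Lemma pact_assoc_inj l z g h :
  assoc l g -> assoc l h -> pact z g = pact z h -> g = h.
Proof.
have F : pact z (s l) = z -> s l = 1.
  by move=> E; apply: contrapT => /(@pact_s_free z l).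
by move=> [->|->] [->|->] //; rewrite pact1 => E; [rewrite F|rewrite F].
Qed.

Lemma off_assoc l z h : assoc l h -> off l (pact z h) = off l z * h.
Proof.
move=> Sh; apply: (@pact_assoc_inj l (rep l z)).
- exact: assoc_off.
- by apply: assocM => //; apply: assoc_off.
- by rewrite -{1}(rep_assoc z Sh) off_rep pactM off_rep.
Qed.

(** The image of [z] under [l] is an existing point: either it is prescribed,
    or [z] arose from the letter [bar l], which is undone. *)
Definition reduces l z : Prop :=
  match z with
  | Base x => D l x
  | Node _ l' h => l' = bar l /\ assoc l h
  end.

Lemma reduces_assoc l z h : assoc l h -> reduces l (pact z h) <-> reduces l z.
Proof.
case: z => [x|z l' k] Sh /=.
  case: Sh => ->; rewrite ?op1 //; split; last exact: D_s.
  by move=> /D_s; rewrite -opM s_sq op1.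
split=> -[-> Sk]; split=> //; last exact: assocM.
by rewrite -[k]mulg1 -[1](mulgV h) (assocV Sh) mulgA; apply: assocM.
Qed.

Definition lact l z : point :=
  if `[< reduces l z >] then
    match z with
    | Base x => Base (phi l x)
    | Node z' _ h => pact z' (twist l h)
    end
  else Node (rep l z) l (twist l (off l z)).

(** Normal forms: a point is a node for at most one choice of representative,
    and no node stands for an already existing point.  On the other points [lact] need
    not be a permutation. *)
Fixpoint valid z : Prop :=
  match z with
  | Base _ => True
  | Node z' l _ => [/\ valid z', rep l z' = z' & ~ reduces l z']
  end.

Lemma valid_pact z g : valid (pact z g) <-> valid z.
Proof. by case: z. Qed.

Lemma reduces_rep l z : reduces l (rep l z) <-> reduces l z.
Proof. by rewrite -{2}(off_rep l z) (reduces_assoc _ (assoc_off _ _)). Qed.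

Lemma valid_rep l z : valid z -> valid (rep l z).
Proof. by case: (repP l z) => -> // ?; apply/valid_pact. Qed.

Lemma valid_lact l z : valid z -> valid (lact l z).
Proof.
rewrite /lact; case: asboolP => [|nr vz]; last first.
  split; [exact: valid_rep|exact: rep_rep|by move/reduces_rep].
by case: z => [x|z l' h] //= _ [vz _ _]; apply/valid_pact.
Qed.

Lemma lactK l z : valid z -> lact (bar l) (lact l z) = z.
Proof.
rewrite {2}/lact; case: asboolP => [|nr vz]; last first.
  rewrite /lact asboolT; last by split; [rewrite barK|exact: assoc_twist].
  by rewrite twistK ?off_rep //; apply: assoc_off.
case: z => [x|z l' h] /=.
  by move=> Dx _; rewrite /lact asboolT /= ?phiK //; apply: D_phi.
move=> [-> Sh] [vz rz nr]; have St := assoc_twist l h.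
rewrite /lact asboolF; last by rewrite reduces_assoc.
rewrite rep_assoc // rz off_assoc // (_ : off _ z = 1) ?mul1g ?twistK //.
by rewrite /off asboolT.
Qed.

Lemma lact_s l z :
  valid z -> lact l (pact z (s l)) = pact (lact l z) (s (bar l)).
Proof.
move=> vz; have Ss := assoc_s l.
rewrite /lact; case: asboolP => [/(reduces_assoc _ Ss)|] r; last first.
  rewrite asboolF; last by move/(reduces_assoc _ Ss).
  by rewrite /= rep_s off_assoc // twistM ?twist_s //; apply: assoc_off.
rewrite asboolT //; case: z r {vz} => [x|z l' h] /= r; first by rewrite phi_s.
by case: r => _ Sh; rewrite twistM // twist_s pactM.
Qed.


(** The group is formed by the words in [G] and [L] modulo equality of their
    actions on the valid points. *)
Definition ev1 z (a : G + L) : point :=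
  match a with inl g => pact z g | inr l => lact l z end.
Definition ev (z : point) (w : seq (G + L)) : point := foldl ev1 z w.

Lemma valid_ev z w : valid z -> valid (ev z w).
Proof.
elim: w z => //= a w IH z vz; apply: IH.
by case: a => [g|l] /=; [apply/valid_pact|apply: valid_lact].
Qed.

Definition ginv (a : G + L) : G + L :=
  match a with inl g => inl g^-1 | inr l => inr (bar l) end.
Definition winv (w : seq (G + L)) := rev (map ginv w).

Lemma ginvK : involutive ginv.
Proof. by case=> [g|l] /=; rewrite ?invgK ?barK. Qed.

Lemma winvK : involutive winv.
Proof. by move=> w; rewrite /winv map_rev revK mapK //; exact: ginvK. Qed.

Lemma ev_winv z w : valid z -> ev z (w ++ winv w) = z.
Proof.
elim: w z => // a w IH z vz.
have -> : (a :: w) ++ winv (a :: w) = a :: ((w ++ winv w) ++ [:: ginv a]).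
  by rewrite /winv /= rev_cons -cats1 catA.
rewrite (_ : ev z _ = ev1 (ev (ev1 z a) (w ++ winv w)) (ginv a)); last first.
  by rewrite /ev /= foldl_cat.
rewrite IH; last first.
  by case: a => [g|l] /=; [apply/valid_pact|apply: valid_lact].
case: a => [g|l] /=; first by rewrite -pactM mulgV pact1.
exact: lactK.
Qed.

Lemma words_group : exists (Q : groupType) (pi : seq (G + L) -> Q),
  [/\ forall q, exists w, pi w = q,
      forall w w', pi w = pi w' <-> forall z, valid z -> ev z w = ev z w'
    & forall w w', pi (w ++ w') = pi w * pi w'].
Proof.
apply: (@quotient_group _ _ [::] winv) => //.
- by move=> w w' E z vz; rewrite E.
- by move=> w1 w2 w3 E E' z vz; rewrite E ?E'.
- move=> w1 w1' w2 w2' E E' z vz; rewrite /ev !foldl_cat -!/(ev _ _) E // E' //.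
  exact: valid_ev.
- by move=> w1 w2 w3 z vz; rewrite catA.
- by move=> w; split=> z vz; rewrite ?cats0.
- move=> w; split=> z vz; last exact: ev_winv.
  by rewrite -{2}(winvK w) ev_winv.
Qed.

(** * Reduced words *)

Section Analysis.
Variables (Q : groupType) (pi : seq (G + L) -> Q).
Hypothesis pi_surj : forall q, exists w, pi w = q.
Hypothesis piE : forall w w',
  pi w = pi w' <-> forall z, valid z -> ev z w = ev z w'.
Hypothesis piM : forall w w', pi (w ++ w') = pi w * pi w'.

Lemma pi_nil : pi [::] = 1.
Proof. by apply: (@mulgI _ (pi [::])); rewrite -piM mulg1. Qed.

Definition qact z (q : Q) : point := ev z (sval (cid (pi_surj q))).

Lemma qact_pi z w : valid z -> qact z (pi w) = ev z w.
Proof. by rewrite /qact; case: cid => w' /= /piE; apply. Qed.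

Lemma valid_qact z q : valid z -> valid (qact z q).
Proof. exact: valid_ev. Qed.

Lemma qactM z p q : valid z -> qact z (p * q) = qact (qact z p) q.
Proof.
case: (pi_surj p) (pi_surj q) => [v <-] [w <-] vz.
by rewrite -piM !qact_pi ?/ev ?foldl_cat //; apply: valid_ev.
Qed.

Lemma qact1 z : valid z -> qact z 1 = z.
Proof. by move=> vz; rewrite -pi_nil qact_pi. Qed.

Definition incl (g : G) : Q := pi [:: inl g].
Definition lett (l : L) : Q := pi [:: inr l].

Lemma inclM g h : incl (g * h) = incl g * incl h.
Proof. by rewrite -piM; apply/piE => z _; apply: pactM. Qed.

Lemma incl1 : incl 1 = 1.
Proof. by rewrite -pi_nil; apply/piE => z _; apply: pact1. Qed.

Lemma inclV g : incl g^-1 = (incl g)^-1.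
Proof. by apply/esym/mulg1_eq; rewrite -inclM mulgV incl1. Qed.

Lemma lett_bar l : lett l * lett (bar l) = 1.
Proof. by rewrite -piM -pi_nil; apply/piE => z vz; apply: lactK. Qed.

Lemma lettV l : (lett l)^-1 = lett (bar l).
Proof. exact/mulg1_eq/lett_bar. Qed.

Lemma lett_s l : incl (s l) * lett l = lett l * incl (s (bar l)).
Proof. by rewrite -!piM; apply/piE => z vz; apply: lact_s. Qed.

Lemma lett_assoc l h : assoc l h -> incl h * lett l = lett l * incl (twist l h).
Proof.
by move=> [->|->]; rewrite ?twist1 ?twist_s ?lett_s // incl1 mulg1 mul1g.
Qed.

(** [[:: (g1, l1); ...; (gn, ln)]] encodes [g1 l1 ... gn ln]. *)
Fixpoint word (t : seq (G * L)) : seq (G + L) :=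
  if t is a :: t' then [:: inl a.1, inr a.2 & word t'] else [::].

Definition value (t : seq (G * L)) : Q := pi (word t).

Lemma value_cons a t : value (a :: t) = incl a.1 * lett a.2 * value t.
Proof. by rewrite -!piM. Qed.

Lemma value1 a : value [:: a] = incl a.1 * lett a.2.
Proof. by rewrite -!piM. Qed.

Lemma value_cat t t' : value (t ++ t') = value t * value t'.
Proof.
rewrite -piM; congr pi.
by elim: t => //= a t ->.
Qed.

Lemma word_form q : exists t g, q = value t * incl g.
Proof.
case: (pi_surj q) => w <-{q}; elim: w => [|a w [t [g E]]].
  by exists [::], 1; rewrite incl1 mulg1.
have -> : pi (a :: w) = pi [:: a] * pi w by rewrite -piM.
rewrite E; case: a => [h|l]; last first.
  by exists ((1, l) :: t), g; rewrite value_cons incl1 mul1g -mulgA.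
case: t {E} => [|b t].
  exists [::], (h * g); rewrite inclM.
  by rewrite [value _]pi_nil !mul1g.
exists ((h * b.1, b.2) :: t), g; rewrite !value_cons /= inclM.
by rewrite -/(incl h) !mulgA.
Qed.

Definition step z (a : G * L) : point := lact a.2 (pact z a.1).

Lemma qact_value z t : valid z -> qact z (value t) = foldl step z t.
Proof. by move=> vz; rewrite qact_pi //; elim: t z {vz} => //= a t IH z. Qed.

(** The word [a b] does not simplify by moving the group element between the two
    letters across the first of them and cancelling. *)
Definition reduced2 (a b : G * L) : bool :=
  `[< ~ (b.2 = bar a.2 /\ assoc b.2 b.1) >].

Fixpoint depth z : nat := if z is Node z' _ _ then (depth z').+1 else 0.

Lemma depth_pact z g : depth (pact z g) = depth z.
Proof. by case: z. Qed.

Lemma depth_rep l z : depth (rep l z) = depth z.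
Proof. by case: (repP l z) => ->; rewrite ?depth_pact. Qed.

(** The point [z] is the image under [l] of a point closer to [X], up to
    an element that moves across [bar l]. *)
Definition pushed l z : Prop :=
  if z is Node _ l' h then l' = l /\ assoc (bar l) h else False.

Lemma lact_push l z : ~ reduces l z ->
  pushed l (lact l z) /\ depth (lact l z) = (depth z).+1.
Proof.
move=> nr; rewrite /lact asboolF //=; split; last by rewrite depth_rep.
by split=> //; apply: assoc_twist.
Qed.

Lemma pushed_reduces l l' z g :
  pushed l z -> reduces l' (pact z g) -> l' = bar l /\ assoc l' g.
Proof.
case: z => //= z' k h [-> Sh] [E Sg]; subst l; rewrite barK in Sh *; split=> //.
by apply/(assocMl _ Sh).
Qed.

(** Coming back along the letter just used would need an element of [{1, s b.2}]
    in between, which is what a reduced word excludes. *)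
Lemma push_step a b z : reduced2 a b -> pushed a.2 z ->
  pushed b.2 (step z b) /\ depth (step z b) = (depth z).+1.
Proof.
move=> /asboolP red pz; rewrite -(depth_pact z b.1); apply: lact_push.
by move/(pushed_reduces pz).
Qed.

Lemma push_path a t z : path reduced2 a t -> pushed a.2 z ->
  pushed (last a t).2 (foldl step z t) /\
  depth (foldl step z t) = (depth z + size t)%N.
Proof.
elim: t a z => [|b t IH] a z /=; first by rewrite addn0.
move=> /andP[ab bt] pz; have [pb db] := push_step ab pz.
by have [] := IH _ _ bt pb; rewrite db addSnnS.
Qed.

(** Britton's lemma.  The letter [c] or its inverse, whichever does
    not cancel with the first letter, leads from [x0] away from [X], and from there every
    letter of a reduced word increases the depth. *)
Lemma value_neq1 a t : path reduced2 a t -> value (a :: t) <> 1.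
Proof.
move=> at_ E.
have [d [ca ncd]] : exists d, reduced2 (1, d) a /\ ~ reduces d (Base x0).
  have [Dc Dcb] := D_c x0.
  have [ac|ac] := EM (a.2 = bar c).
    exists (bar c); split=> //; apply/asboolP => -[].
    by rewrite ac barK => /c_bar.
  by exists c; split=> //; apply/asboolP => -[].
have [pc dc] := lact_push ncd; set z := lact d _ in pc dc.
have vz : valid z by apply: valid_lact.
have := qact_value (a :: t) vz; rewrite E qact1 // => /(congr1 depth).
have [|_ ->] := @push_path (1, d) (a :: t) z _ pc; first by rewrite /= ca.
by move/eqP; rewrite -[X in X == _]addn0 eqn_add2l.
Qed.

Fixpoint base_path x (t : seq (G * L)) : Prop :=
  if t is a :: t' then D a.2 (op x a.1) /\ base_path (phi a.2 (op x a.1)) t'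
  else True.

Lemma step_cases a z :
  [\/ pushed a.2 (step z a) /\ depth (step z a) = (depth z).+1,
      (depth (step z a) < depth z)%N
    | exists x, [/\ z = Base x, D a.2 (op x a.1)
                  & step z a = Base (phi a.2 (op x a.1))]].
Proof.
have [r|nr] := EM (reduces a.2 (pact z a.1)); last first.
  by apply: Or31; rewrite -(depth_pact z a.1); apply: lact_push.
rewrite /step /lact asboolT //; case: z r => [x|z l h] /= r.
  by apply: Or33; exists x.
by apply: Or32; rewrite depth_pact.
Qed.

Lemma base_path_step x a : D a.2 (op x a.1) ->
  step (Base x) a = Base (phi a.2 (op x a.1)).
Proof. by move=> Dx; rewrite /step /lact asboolT. Qed.

Lemma base_path_end x t : base_path x t ->
  exists y, foldl step (Base x) t = Base y.
Proof.
elim: t x => [|a t IH] x /=; first by exists x.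
by move=> [Dx /IH]; rewrite base_path_step.
Qed.

(** Along a reduced word the depth first decreases, then possibly stays [0] for
    some time, then increases; the three cases record the last phase
    reached. *)
Lemma path_cases a t z : path reduced2 a t ->
  [\/ pushed (last a t).2 (foldl step z (a :: t)),
      (depth (foldl step z (a :: t)) < depth z)%N
    | exists x, z = Base x /\ base_path x (a :: t)].
Proof.
elim: t a z => [|b t IH] a z.
  case: (step_cases a z) => [[pz _]|lt|[x [-> Dx _]]] _; first exact: Or31.
    exact: Or32.
  by apply: Or33; exists x.
move=> abt; have /andP[ab bt] : reduced2 a b && path reduced2 b t by [].
case: (step_cases a z) => [[pz _]|lt|[x [-> Dx E]]].
- by apply: Or31; case: (push_path abt pz).
- case: (IH b (step z a) bt) => [|lt'|[x [E bp]]]; first exact: Or31.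
    by apply: Or32; apply: ltn_trans lt.
  have [y Ey] := base_path_end bp.
  have -> : foldl step z [:: a, b & t] = Base y by rewrite -Ey -E.
  by apply: Or32; apply: leq_ltn_trans lt.
- rewrite [foldl _ _ _]/= E; case: (IH b (Base (phi a.2 (op x a.1))) bt) => [|//|].
    exact: Or31.
  by move=> [y [[<-] bp]]; apply: Or33; exists x.
Qed.

(** If a cyclically reduced word ended by moving away from [X], then reading it
    again would increase the depth at every letter, although the word
    fixes [z]. *)
Lemma cycle_fix a t z : cycle reduced2 (a :: t) ->
  foldl step z (a :: t) = z -> exists x, z = Base x /\ base_path x (a :: t).
Proof.
rewrite /= rcons_path => /andP[at_ ta] E.
have F : foldl step z (a :: t) = z by [].
case: (path_cases z at_) => [|lt|//]; last by rewrite F ltnn in lt.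
rewrite F => pz.
have [|_] := @push_path (last a t) (a :: t) z _ pz; first by rewrite /= ta.
by rewrite F => /eqP; rewrite -[X in X == _]addn0 eqn_add2l.
Qed.

Lemma base_path_last x a t y : base_path x (a :: t) ->
  foldl step (Base x) (a :: t) = Base y -> D (bar (last a t).2) y.
Proof.
elim: t a x => [|b t IH] a x.
  by move=> [Dx _]; rewrite /= base_path_step // => -[<-]; apply: D_phi.
by move=> [Dx bp]; rewrite [foldl _ _ _]/= base_path_step //; apply: IH.
Qed.

Lemma phi_inj l x y : D l x -> D l y -> phi l x = phi l y -> x = y.
Proof. by move=> Dx Dy E; rewrite -(phiK Dx) E phiK. Qed.

Lemma op_inj g x y : op x g = op y g -> x = y.
Proof. by move=> E; rewrite -(op1 x) -(mulgV g) opM E -opM mulgV op1. Qed.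

(** In a reduced word, two distinct points can only pass from one
    letter to the next through the centre of the star. *)
Lemma base_pair_out a b x y : x <> y -> reduced2 a b ->
  D (bar a.2) x -> D (bar a.2) y -> D b.2 (op x b.1) -> D b.2 (op y b.1) ->
  out (bar a.2) /\ out b.2.
Proof.
move=> xy /asboolP ab Dx Dy Dx' Dy'.
by case: (D_pairs xy Dx Dy Dx' Dy') => // -[E S]; case: ab; rewrite E; split.
Qed.

(** Both orbits entered and left by the first letter would be
    the centre of the star, but a letter joins the centre to a leaf. *)
Lemma cycle_fix_unique a t z1 z2 : cycle reduced2 (a :: t) ->
  foldl step z1 (a :: t) = z1 -> foldl step z2 (a :: t) = z2 -> z1 = z2.
Proof.
move=> cyc E1 E2; apply: contrapT => ne.
have [x [Ex bx]] := cycle_fix cyc E1; have [y [Ey by_]] := cycle_fix cyc E2.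
subst z1 z2; have {ne} xy : x <> y by move=> E; apply: ne; rewrite E.
have Dx := base_path_last bx E1; have Dy := base_path_last by_ E2.
move: cyc; rewrite /= rcons_path => /andP[at_ ta].
case: bx => Dxa bx; case: by_ => Dya by_.
have [_ oa] := base_pair_out xy ta Dx Dy Dxa Dya.
case: t at_ ta bx by_ Dx Dy {E1 E2} => [|b t] at_ ta bx by_ Dx Dy.
  by have [/out_bar] := base_pair_out xy ta Dx Dy Dxa Dya; rewrite barK.
have {at_} /andP[ab _] := at_.
have xy' : phi a.2 (op x a.1) <> phi a.2 (op y a.1).
  by move/(phi_inj Dxa Dya)/op_inj.
case: bx by_ => Dxb _ [Dyb _].
by have [/out_bar] := base_pair_out xy' ab (D_phi Dxa) (D_phi Dya) Dxb Dyb; rewrite barK.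
Qed.

Lemma self_bar_nofix a z : bar a.2 = a.2 -> step z a <> z.
Proof.
move=> E; case: (step_cases a z) => [[_ dz]|lt|[x [_ /(D_self E)]]] // F.
  by move/eqP: dz; rewrite F -[X in X == _]addn0 -addn1 eqn_add2l.
by rewrite F ltnn in lt.
Qed.

Lemma not_path_split (T : Type) (r : rel T) x p : ~~ path r x p ->
  exists p1 y p2, p = p1 ++ y :: p2 /\ ~~ r (last x p1) y.
Proof.
elim: p x => //= y p IH x; rewrite negb_and => /orP[nr|/IH[p1 [z [p2 [-> nr]]]]].
  by exists [::], y, p.
by exists (y :: p1), z, p2.
Qed.

Definition conjugate (p q : Q) := exists d, q = p ^ d.

Lemma conjugate_trans p q r :
  conjugate p q -> conjugate q r -> conjugate p r.
Proof. by move=> [d ->] [d' ->]; exists (d * d'); rewrite conjgM. Qed.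

Lemma conjugate_mulC p q : conjugate (p * q) (q * p).
Proof. by exists p; rewrite conjgE mulgA mulKg. Qed.

(** Conjugation rotates words; a word that is not cyclically reduced can be
    rotated so that its last and first letters cancel, which shortens it.  A word of length one
    whose letter is its own inverse is an exception, as there the last and first
    letters are the same occurrence. *)
Lemma cyclic_form q : exists2 r, conjugate q r &
  [\/ exists g, r = incl g,
     exists a t, cycle reduced2 (a :: t) /\ r = value (a :: t)
   | exists a, bar a.2 = a.2 /\ r = value [:: a]].
Proof.
have [t [g ->{q}]] := word_form q.
have [n] := ubnP (size t); elim: n t g => // n IH t g; rewrite ltnS => le_tn.
case: t le_tn => [|a t] le_tn.
  exists (incl g); last by apply: Or31; exists g.
  by exists 1; rewrite conjg1 [value _]pi_nil mul1g.
have [a' C] : exists a', conjugate (value (a :: t) * incl g) (value (a' :: t)).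
  exists (g * a.1, a.2).
  rewrite (_ : value ((g * a.1, a.2) :: t) = incl g * value (a :: t)).
    exact: conjugate_mulC.
  by rewrite !value_cons inclM !mulgA.
have [cyc|ncyc] := boolP (cycle reduced2 (a' :: t)).
  by exists (value (a' :: t)) => //; apply: Or32; exists a', t.
(* rotate so that the non-reduced pair is formed by the last and first letters *)
have [b [u [sz Cu /asboolPn/contrapT[bE Sb]]]] : exists b u, [/\ size u = size t,
    conjugate (value (a' :: t)) (value (b :: u)) & ~~ reduced2 (last b u) b].
  have [p1 [b [p2 [E nr]]]] := not_path_split ncyc.
  case/lastP: p2 E => [|p2 d] E.
    move: E nr; rewrite cats1 => /rcons_inj[-> <-] nr; exists a', p1; split=> //.
    by exists 1; rewrite conjg1.
  move: E; rewrite -rcons_cons -rcons_cat => /rcons_inj[-> _].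
  exists b, (p2 ++ a' :: p1); split; first by rewrite !size_cat /= !addnS addnC.
    by rewrite -!cat_cons !value_cat; apply: conjugate_mulC.
  by rewrite last_cat.
have {}C := conjugate_trans C Cu.
case/lastP: u sz C bE {Cu} => [|u d] sz C bE.
  by exists (value [:: b]) => //; apply: Or33; exists b.
rewrite last_rcons in bE.
have /IH : (size u < n)%N by apply: leq_trans le_tn; rewrite /= -sz size_rcons.
move=> /(_ (d.1 * twist b.2 b.1))[r Cr ?]; exists r => //; apply: conjugate_trans Cr.
apply: (conjugate_trans C); rewrite -cat1s value_cat.
rewrite (_ : _ * incl _ = value (rcons u d) * value [:: b]); first exact: conjugate_mulC.
rewrite -cats1 value_cat !value1 (lett_assoc Sb) inclM bE !mulgA.
by rewrite -(mulgA _ (lett d.2)) lett_bar mulg1.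
Qed.

Lemma step_value z a : valid z -> qact z (value [:: a]) = step z a.
Proof. exact: qact_value. Qed.

Lemma qact_incl z g : valid z -> qact z (incl g) = pact z g.
Proof. exact: qact_pi. Qed.

Lemma qact_conj z q d : valid z -> qact z q = z -> qact (qact z d) (q ^ d) = qact z d.
Proof. by move=> vz E; rewrite -qactM // -conjgC qactM // E. Qed.

Lemma qact_inj z1 z2 d : valid z1 -> valid z2 -> qact z1 d = qact z2 d -> z1 = z2.
Proof.
by move=> v1 v2 E; rewrite -(qact1 v1) -(mulgV d) qactM // E -qactM // mulgV qact1.
Qed.

Lemma pact_fix_node z l h g : pact (Node z l h) g = Node z l h -> g = 1.
Proof. by move=> -[]; rewrite -[in RHS](mulg1 h) => /mulgI. Qed.

Lemma incl_inj : injective incl.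
Proof.
suff inj1 g : incl g = 1 -> g = 1.
  move=> g h E; apply/divg1_eq/inj1.
  by rewrite inclM inclV E mulgV.
have vc : valid (lact c (Base x0)) by apply: valid_lact.
move=> /(congr1 (qact (lact c (Base x0)))); rewrite qact_incl // qact1 //.
have [nc _] := D_c x0; have [+ _] := lact_push (l := c) (z := Base x0) nc.
by case: (lact c _) => // z l h _ /pact_fix_node.
Qed.

Lemma qact_two z1 z2 q : valid z1 -> valid z2 -> z1 <> z2 ->
  qact z1 q = z1 -> qact z2 q = z2 -> q = 1.
Proof.
move=> v1 v2 ne E1 E2.
have [_ [d ->] form] := cyclic_form q.
suff /eqP: q ^ d = 1 by rewrite conjg_eq1 => /eqP.
have {ne} : qact z1 d <> qact z2 d by move/(qact_inj v1 v2).
have {E1} := qact_conj d v1 E1; have {E2} := qact_conj d v2 E2.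
have {v1} := valid_qact d v1; have {v2} := valid_qact d v2.
move: (qact z1 d) (qact z2 d) => {}z1 {}z2 v2 v1 E2 E1 ne.
case: form => [[g E]|[a [t [cyc E]]]|[a [sb E]]]; rewrite {}E in E1 E2 *.
- rewrite !qact_incl // in E1 E2.
  suff -> : g = 1 by rewrite incl1.
  case: z1 z2 E1 E2 ne {v1 v2} => [x|z l h] [y|z' l' h'];
    try by move=> *; apply: pact_fix_node; eassumption.
  by move=> [Ex] [Ey] ne; apply: (op_two _ Ex Ey) => E; apply: ne; rewrite E.
- rewrite !qact_value // in E1 E2.
  by case: ne; apply: cycle_fix_unique E1 E2.
- rewrite step_value // in E1.
  by case: (self_bar_nofix sb E1).
Qed.

(** The square of a cyclically reduced word is reduced, so an involution is
    conjugate to one of [G] or to a word of length one with a self-inverse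
    letter, which moves every point by changing its depth. *)
Lemma qact_involution z q : valid z -> q <> 1 -> q * q = 1 -> qact z q <> z.
Proof.
move=> vz q1 qq E.
have [_ [d ->] form] := cyclic_form q.
have : q ^ d <> 1 by move/eqP; rewrite conjg_eq1 => /eqP.
have : q ^ d * q ^ d = 1 by rewrite -conjMg qq conj1g.
have {E} := qact_conj d vz E; have {vz} := valid_qact d vz.
move: (qact z d) => {}z vz.
case: form => [[g ->]|[a [t [cyc ->]]]|[a [sb ->]]] E.
- rewrite qact_incl // in E.
  rewrite -inclM => gg g1.
  have {}g1 : g <> 1 by move=> G1; apply: g1; rewrite G1 incl1.
  case: z E {vz} => [x [E]|z l h]; last by move/pact_fix_node.
  apply: (@op_inv x g) => //.
  by apply: incl_inj; rewrite gg incl1.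
- rewrite -value_cat => /value_neq1; case=> //.
  by move: cyc; rewrite /= rcons_path cat_path /= => /andP[-> ->].
- by rewrite step_value // in E; case: (self_bar_nofix sb E).
Qed.

Lemma lett_neq1 l : lett l <> 1.
Proof. by have := @value_neq1 (1, l) [::] isT; rewrite value1 incl1 mul1g. Qed.

(** The commutator is the value of a reduced word of length four. *)
Lemma incl_conj_free n : n <> 1 -> ~ commute (incl n) (incl n ^ lett c).
Proof.
move=> n1 cn.
have nV1 : n^-1 <> 1 by move=> E; apply: n1; rewrite -(invgK n) E invg1.
apply: (@value_neq1 (n, bar c) [:: (n, c); (n^-1, bar c); (n^-1, c)]).
  by rewrite /= !andbT; apply/and3P; split; apply/asboolP => -[_] [] //=;
    rewrite ?s_c ?(s_bar s_c).
have -> : value [:: (n, bar c); (n, c); (n^-1, bar c); (n^-1, c)] =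
          incl n * (incl n ^ lett c) / (incl n ^ lett c * incl n).
  rewrite !value_cons [value _]pi_nil mulg1 /= invgM !conjgE !invgM invgK.
  by rewrite !inclV lettV !mulgA.
by rewrite cn mulgV.
Qed.

Definition base_stab : set Q := [set q | qact (Base x0) q = Base x0].

Lemma base_stab_incl g : base_stab (incl g) <-> op x0 g = x0.
Proof. by rewrite /base_stab /= qact_incl //=; split=> [[]|->]. Qed.

Lemma malnormal_base_stab : malnormal base_stab.
Proof.
have v0 : valid (Base x0) by [].
split.
- apply/subgroupP; split; rewrite /base_stab /=; first exact: qact1.
    by move=> p q Bp Bq; rewrite qactM // Bp.
  by move=> q Bq; rewrite -{1}Bq -qactM // mulgV qact1.
- have [nc _] := D_c x0; have [_] := lact_push (l := c) (z := Base x0) nc.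
  move=> + E; have : base_stab (lett c) by rewrite E.
  by rewrite /base_stab /= qact_pi //= => ->.
- move=> g ng; apply/seteqP; split=> [q [/= Bq [r Br Er]]|_ ->]; last first.
    by split; [apply: qact1|exists 1; rewrite ?conj1g //; apply: qact1].
  apply: (@qact_two (Base x0) (qact (Base x0) g)) => //.
  - exact: valid_qact.
  - by move=> E; apply: ng.
  - by rewrite -Er qact_conj.
Qed.

Lemma base_stab_lett l g h : D l (op x0 g) -> phi l (op x0 g) = op x0 h ->
  base_stab (incl g * lett l / incl h).
Proof.
move=> Dg E; rewrite /base_stab /= qactM // -(value1 (g, l)) step_value //.
by rewrite base_path_step //= E -inclV qact_incl //= -opM mulgV op1.
Qed.

End Analysis.

(** [B] is the stabiliser of [x0]; its description on letters says that
    [x0 g l h^-1 = x0] whenever [l] was prescribed to send [x0 g] to [x0 h]. *)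
Theorem free_extension :
  exists (Q : groupType) (incl : G -> Q) (lett : L -> Q) (B : set Q),
  [/\ {morph incl : g h / g * h}, injective incl, malnormal B,
      forall q, B q -> ~ involution q
    & exists pi : seq (G + L) -> Q, forall q, exists w, pi w = q] /\
  [/\ forall g, B (incl g) <-> op x0 g = x0,
      forall l, lett l * lett (bar l) = 1 /\ lett l <> 1,
      forall l, incl (s l) * lett l = lett l * incl (s (bar l)),
      forall l g h, D l (op x0 g) -> phi l (op x0 g) = op x0 h ->
        B (incl g * lett l / incl h)
    & forall n, n <> 1 -> ~ commute (incl n) (incl n ^ lett c)].
Proof.
have [Q [pi [pi_surj piE piM]]] := words_group.
exists Q, (incl pi), (lett pi), (base_stab pi_surj); split; split.
- exact: inclM.
- exact: (incl_inj pi_surj).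
- exact: malnormal_base_stab.
- by move=> q Bq [q1]; rewrite expgS expg1 => qq; apply: (qact_involution _ _ _ q1 qq Bq).
- by exists pi.
- exact: base_stab_incl.
- by move=> l; split; [exact: lett_bar|exact: (lett_neq1 pi_surj)].
- exact: lett_s.
- exact: base_stab_lett.
- exact: (incl_conj_free pi_surj).
Qed.

End Completion.

(** * Malnormal subgroups and their coset spaces *)

Section CosetSpace.
Variables (G : groupType) (A : set G).
Hypothesis malA : malnormal A.

Lemma malnormal1 : A 1.
Proof. by have [/subgroupP[]] := malA. Qed.

Lemma malnormalM x y : A x -> A y -> A (x * y).
Proof. by have [/subgroupP[_ AM _] _ _] := malA; apply: AM. Qed.

Lemma malnormalV x : A x -> A x^-1.
Proof. by have [/subgroupP[_ _ AV] _ _] := malA; apply: AV. Qed.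

Lemma malnormalMl a x : A a -> A (a * x) <-> A x.
Proof.
move=> Aa; split=> [Aax|]; last exact: malnormalM.
by rewrite -(mulKg a x); apply: malnormalM => //; apply: malnormalV.
Qed.

Lemma malnormalMr a x : A a -> A (x * a) <-> A x.
Proof.
move=> Aa; split=> [Aax|Ax]; last exact: malnormalM.
by rewrite -(mulgK a x); apply: malnormalM => //; apply: malnormalV.
Qed.

(** With [coset_two], the link between malnormality and actions: a nontrivial
    element of [A] fixes no coset other than [A]. *)
Lemma malnormalJ a g : ~ A g -> A a -> A (a ^ g) -> a = 1.
Proof.
move=> nAg Aa Aag; have [_ _ /(_ g nAg) E] := malA.
have : (A `&` [set x ^ g | x in A]) (a ^ g) by split=> //; exists a.
by rewrite E /= => /eqP; rewrite conjg_eq1 => /eqP.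
Qed.

Lemma rcoset_eq (g h : G) : rcoset A g = rcoset A h <-> A (g / h).
Proof.
split=> [E|Agh].
  have : rcoset A g g by exists 1; rewrite ?mul1g //; apply: malnormal1.
  by rewrite E => -[a Aa <-]; rewrite mulgK.
apply/seteqP; split=> _ [a Aa <-].
  by exists (a * (g / h)); rewrite -?mulgA ?mulVg ?mulg1 //; apply: malnormalM.
exists (a * (h / g)); rewrite -?mulgA ?mulVg ?mulg1 //; apply: malnormalM => //.
by rewrite -invgF; apply: malnormalV.
Qed.

Lemma coset_space : exists (X : Type) (op : X -> G -> X) (x0 : X),
  [/\ forall x, op x 1 = x, forall x g h, op x (g * h) = op (op x g) h,
      forall g, op x0 g = x0 <-> A g & forall x, exists g, x = op x0 g].
Proof.
pose X := {C : set G | rcosets A C}.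
pose op (C : X) g : X := exist _ _ (rcosets_closed g (svalP C)).
have A0 : rcosets A A by exists 1 => //; apply: rcoset1.
exists X, op, (exist _ A A0); split.
- by move=> [C HC]; apply: eq_exist; apply: rcoset1.
- by move=> [C HC] g h; apply: eq_exist; apply: rcosetM.
- move=> g; rewrite -[g in A g]divg1 -rcoset_eq rcoset1; split=> [[]//|E].
  exact: eq_exist.
- by move=> [C HC]; have [g _ E] := HC; exists g; apply: eq_exist.
Qed.

Variables (X : Type) (op : X -> G -> X) (x0 : X).
Hypothesis opM : forall x g h, op x (g * h) = op (op x g) h.
Hypothesis op_stab : forall g, op x0 g = x0 <-> A g.
Hypothesis op_trans : forall x, exists g, x = op x0 g.
Hypothesis noinv : forall t, A t -> ~ involution t.

Lemma op_eq g h : op x0 g = op x0 h <-> A (g / h).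
Proof.
rewrite -op_stab opM; split=> [->|E].
  by rewrite -opM mulgV; apply/op_stab/malnormal1.
by rewrite -[in RHS]E -!opM ?mulgA mulgVK.
Qed.

Lemma op_fix g h : op (op x0 h) g = op x0 h <-> A (g ^ h^-1).
Proof. by rewrite -opM op_eq conjgE invgK mulgA. Qed.

Lemma coset_two x y g : x <> y -> op x g = x -> op y g = y -> g = 1.
Proof.
case: (op_trans x) (op_trans y) => [h ->] [k ->] ne /op_fix Ah /op_fix Ak.
apply/eqP; rewrite -(conjg_eq1 g h^-1); apply/eqP.
apply: (@malnormalJ _ (h / k)) => //; first by move/op_eq.
by rewrite -conjgM mulKg.
Qed.

Lemma coset_inv x g : g * g = 1 -> g <> 1 -> op x g <> x.
Proof.
case: (op_trans x) => [h ->] gg g1 /op_fix /noinv; apply; split.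
  by move/eqP; rewrite conjg_eq1 => /eqP.
by rewrite expgS expg1 -conjMg gg conj1g.
Qed.

End CosetSpace.

(** * Adjoining an involution *)

(** The letter [None] is its own inverse, and [Some true] is the free letter
    required by [free_extension]; no values are prescribed. *)
Lemma adjoin_involution (G : groupType) (A : set G) : malnormal A ->
    (forall t, A t -> ~ involution t) ->
  exists (Q : groupType) (incl : G -> Q) (B : set Q) (t : Q),
  [/\ {morph incl : g h / g * h}, injective incl, malnormal B,
      forall q, B q -> ~ involution q & involution t] /\
  [/\ forall g, B (incl g) <-> A g
    & exists pi : seq (G + option bool) -> Q, forall q, exists w, pi w = q].
Proof.
move=> malA noinv.
have [X [op [x0 [op1 opM op_stab op_trans]]]] := coset_space malA.
have := @free_extension G X op op1 opM (coset_inv malA opM op_stab op_trans noinv)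
  (coset_two malA opM op_stab op_trans) (option bool) (omap negb) (fun=> 1) _ _ _
  (fun _ _ => False) (fun _ x => x) _ _ _ _ _ (fun=> False) _ _ (Some true) x0.
case=> //; first by case=> // b; rewrite /= negbK.
- by move=> l; rewrite mulg1.
- by move=> *; case.
- by move=> x; split; case.
move=> Q [incl [lett [B [[inclM incl_inj malB noinvB surj]]]]].
move=> [B_incl lett_bar _ _ _].
exists Q, incl, B, (lett None); split; split=> //.
  by have [tt t1] := lett_bar None; split=> //; rewrite expgS expg1.
by move=> g; rewrite B_incl op_stab.
Qed.

(** * Moving all pairs to one orbit *)

Section MovePairs.
Variables (G : groupType) (A : set G).
Hypothesis malA : malnormal A.
Hypothesis noinv : forall t, A t -> ~ involution t.

(** The unordered pairs [{A, A u}] and [{A, A v}] lie in the same orbit. *)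
Definition coset_equiv (u v : G) : Prop :=
  exists a b, [/\ A a, A b & v = a * u * b \/ v = a * u^-1 * b].

Lemma coset_equiv_refl u : coset_equiv u u.
Proof.
by exists 1, 1; rewrite mul1g mulg1; have A1 := malnormal1 malA; split=> //; left.
Qed.

Lemma coset_equiv_sym u v : coset_equiv u v -> coset_equiv v u.
Proof.
move=> [a [b [Aa Ab [->|->]]]].
  exists a^-1, b^-1; split; try exact: malnormalV.
  by left; rewrite !mulgA mulVg mul1g mulgK.
exists b, a; split=> //; right.
by rewrite !invgM invgK !mulgA mulgV mul1g mulgVK.
Qed.

Lemma coset_equiv_trans u v w :
  coset_equiv u v -> coset_equiv v w -> coset_equiv u w.
Proof.
move=> [a [b [Aa Ab Ev]]] [a' [b' [Aa' Ab' Ew]]].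
have [AM AV] := (malnormalM malA, malnormalV malA).
case: Ew => [->|->]; last first.
  exists (a' * b^-1), (a^-1 * b'); split; [exact/AM/AV|by apply: AM => //; apply: AV|].
  by case: Ev => ->; [right|left]; rewrite !invgM ?invgK !mulgA.
exists (a' * a), (b * b'); split; [exact: AM|exact: AM|].
by case: Ev => ->; [left|right]; rewrite !mulgA.
Qed.

(** When [{A, A u}] is swapped by some element of [G], its orbit contains
    a pair [{A, A v}] with [v] an involution swapping it; such [v] is preferred,
    for then the associated subgroup is generated by the representative itself. *)
Lemma involutive_representatives : exists r : G -> G, forall u,
  [/\ coset_equiv u (r u), forall v, coset_equiv u v -> r u = r v
    & forall v, coset_equiv u v -> v * v = 1 -> r u * r u = 1].
Proof.
have [c cP] := class_representatives coset_equiv_refl coset_equiv_sym coset_equiv_trans.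
pose sel (u v : G) := coset_equiv u v /\ v * v = 1.
pose r u := if pselect (exists v, sel (c u) v) is left e then sval (cid e) else c u.
exists r => u; have [uc cu] := cP u; have cu_sym := coset_equiv_sym uc.
rewrite /r; split=> [|v /cu -> //|v uv vv]; case: pselect => //.
  by move=> e; case: cid => v /= [cv _]; apply: coset_equiv_trans cv.
  by move=> e; case: cid => w /= [].
by case; exists v; split=> //; apply: coset_equiv_trans uv.
Qed.

Variables (t : G).
Hypothesis inv_t : involution t.

(** One step of the construction.  The letter [(v, false)] sends [(A, A t)] to
    [(A, A v)], where [v] runs through the representatives of the orbits other
    than that of [t]; if [v] is an involution, then conjugation by this letter
    sends [t] to [v].  The letters [(v, _)] for the remaining [v] are free, and [(1, false)]
    serves as the letter [c]. *)
Lemma move_pairs :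
  exists (Q : groupType) (incl : G -> Q) (B : set Q),
  [/\ {morph incl : g h / g * h}, injective incl, malnormal B
    & forall q, B q -> ~ involution q] /\
  [/\ forall g, B (incl g) <-> A g,
      forall u, ~ A u -> exists f, B f /\ B (incl t * f / incl u),
      forall n, n <> 1 -> exists d, ~ commute (incl n) (incl n ^ d)
    & exists pi : seq (G + G * bool) -> Q, forall q, exists w, pi w = q].
Proof.
have [X [op [x0 [op1 opM op_stab op_trans]]]] := coset_space malA.
have [r rP] := involutive_representatives.
have tt : t * t = 1 by case: inv_t; rewrite expgS expg1.
have nAt : ~ A t by move=> /noinv.
pose I v := [/\ ~ A v, ~ coset_equiv t v & r v = v].
pose u (l : G * bool) := if l.2 then l.1 else t.
pose bar (l : G * bool) := (l.1, ~~ l.2).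
pose s l := if `[< I l.1 /\ l.1 * l.1 = 1 >] then u l else 1.
pose D l x := I l.1 /\ (x = x0 \/ x = op x0 (u l)).
pose phi l x := if `[< x = x0 >] then x0 else op x0 (u (bar l)).
have barK : involutive bar by move=> [v b]; rewrite /bar /= negbK.
have nAu l : I l.1 -> ~ A (u l) by move=> [nA _ _]; rewrite /u; case: ifP.
have u0 l : I l.1 -> op x0 (u l) <> x0 by move=> /nAu nA /op_stab.
have phi0 l : phi l x0 = x0 by rewrite /phi asboolT.
have phiu l : I l.1 -> phi l (op x0 (u l)) = op x0 (u (bar l)).
  by move=> Il; rewrite /phi asboolF //; apply: u0.
have sP l : s l = 1 /\ s (bar l) = 1 \/
    [/\ I l.1, s l = u l, s (bar l) = u (bar l), u l * u l = 1
      & u (bar l) * u (bar l) = 1].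
  rewrite /s /=; case: asboolP => [[Il ll]|_]; [right|by left].
  by rewrite /u; case: l Il ll => v [] /=.
have s_sq l : s l * s l = 1.
  by case: (sP l) => [[-> _]|[_ -> _ -> _]]; rewrite ?mulg1.
have s_bar l : s l = 1 -> s (bar l) = 1.
  case: (sP l) => [[] //|[Il -> _ _ _] u1].
  by case: (u0 l Il); rewrite u1 op1.
have D_phi l x : D l x -> D (bar l) (phi l x).
  move=> [Il [->|->]]; split=> //; first by left; apply: phi0.
  by right; apply: phiu.
have phiK l x : D l x -> phi (bar l) (phi l x) = x.
  by move=> [Il [->|->]]; rewrite ?phi0 // phiu // phiu // barK.
have D_s l x : D l x -> D l (op x (s l)).
  case: (sP l) => [[-> _]|[_ -> _ uu _]]; first by rewrite op1.
  move=> [Il [->|->]]; split=> //; first by right.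
  by left; rewrite -opM uu op1.
have phi_s l x : D l x -> phi l (op x (s l)) = op (phi l x) (s (bar l)).
  case: (sP l) => [[-> ->]|[_ -> -> uu uu']]; first by rewrite !op1.
  move=> [Il [->|->]]; first by rewrite phi0 phiu.
  by rewrite -opM uu op1 phi0 phiu // -opM uu' op1.
have D_pairs l l' x y g : x <> y -> D l x -> D l y ->
    D l' (op x g) -> D l' (op y g) ->
    (l' = l /\ assoc_sub (s l) g) \/ (~~ l.2 /\ ~~ l'.2).
  (* [h] sends the pair of [l1] to that of [l2], in one of the two orders *)
  pose moved (l1 l2 : G * bool) h := (A h /\ A (u l1 * h / u l2)) \/
    (A (h / u l2) /\ A (u l1 * h)).
  move=> xy Dx Dy Dx' Dy'.
  have [Il [Il' pr]] : I l.1 /\ (I l'.1 /\ moved l l' g).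
    have ne : op x g <> op y g.
      by move=> E; apply: xy; rewrite -(op1 x) -(mulgV g) opM E -opM mulgV op1.
    case: Dx Dy Dx' Dy' => [Il Ex] [_ Ey] [Il' Ex'] [_ Ey']; split=> //; split=> //.
    have P : op x0 g = x0 -> op (op x0 (u l)) g = op x0 (u l') -> moved l l' g.
      by move=> /op_stab Ag; rewrite -opM => /(op_eq malA opM op_stab); left.
    have P' : op x0 g = op x0 (u l') -> op (op x0 (u l)) g = x0 -> moved l l' g.
      by move=> /(op_eq malA opM op_stab) Ag; rewrite -opM => /op_stab; right.
    case: Ex Ey xy ne Ex' Ey' => -> [->|->] xy // ne.
    + by move=> [E|E] [E'|E']; [case: ne; rewrite E E'|apply: P|apply: P'|
        case: ne; rewrite E E'].
    + by move=> [E|E] [E'|E']; [case: ne; rewrite E E'|apply: P'|apply: P|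
        case: ne; rewrite E E'].
  have Euu : coset_equiv (u l) (u l').
    case: pr => -[A1 A2].
      exists (u l * g / u l')^-1, g; split=> //; first exact: malnormalV.
      by left; rewrite !invgM invgK !mulgA mulgVK mulgVK.
    exists (g / u l')^-1, (u l * g); split=> //; first exact: malnormalV.
    by right; rewrite invgM invgK !mulgA !mulgVK.
  have [lf|lt] := boolP (~~ l.2).
    have [l'f|l't] := boolP (~~ l'.2); first by right.
    by move: Euu; rewrite /u (negPf lf) (negPn l't); have [_ nt _] := Il'; move/nt.
  have [l'f|l't] := boolP (~~ l'.2).
    move: Euu => /coset_equiv_sym; rewrite /u (negPf l'f) (negPn lt).
    by have [_ nt _] := Il; move/nt.
  have {}lt := negPn lt; have {}l't := negPn l't.
  left; have Ell : l' = l.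
    have E : l'.1 = l.1.
      case: Il Il' Euu => _ _ <- [_ _ <-]; rewrite /u lt l't => Euu.
      by have [_ /(_ _ Euu)] := rP l.1.
    by case: l l' E lt l't {Dx Dy Dx' Dy' Il Il' pr Euu} => v b [v' b'] /= -> -> ->.
  split=> //; rewrite {}Ell in pr.
  have fix1 h : op x0 h = x0 -> op (op x0 (u l)) h = op x0 (u l) -> h = 1.
    by apply: (coset_two malA opM op_stab op_trans) => /esym/(u0 _ Il).
  case: pr => -[A1 A2].
    left; apply: fix1; first exact/op_stab.
    by rewrite -opM; apply/(op_eq malA opM op_stab).
  have g1 : op x0 g = op x0 (u l) by apply/(op_eq malA opM op_stab).
  have g2 : op (op x0 (u l)) g = x0 by rewrite -opM; apply/op_stab.
  (* [g] swaps the pair, so it is an involution equivalent to [u l] *)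
  have gg : g * g = 1 by apply: fix1; rewrite opM ?g1 ?g2 ?g1.
  have ul : u l = l.1 by rewrite /u lt.
  have ll : l.1 * l.1 = 1.
    have [_ _ rl] := Il; rewrite -rl; have [_ _ /(_ g)] := rP l.1; apply=> //.
    exists (g / u l), 1; split=> //; first exact: malnormal1.
    by left; rewrite ul mulgVK mulg1.
  right; rewrite /s asboolT // -[RHS]mul1g; rewrite -ul in ll.
  have gu : g * u l = 1 by apply: fix1; rewrite opM ?g1 ?g2 // -opM ll op1.
  by rewrite -gu -mulgA ll mulg1.
have := @free_extension G X op op1 opM (coset_inv malA opM op_stab op_trans noinv)
  (coset_two malA opM op_stab op_trans) _ bar s barK s_sq s_bar D phi D_phi phiK
  D_s phi_s _ (fun l => ~~ l.2) _ D_pairs (1, false) x0.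
have nI1 : ~ I 1 by case=> /(_ (malnormal1 malA)).
case=> //.
- by move=> [v []].
- by move=> [v []] /=.
- by rewrite /s asboolF //; case.
- by move=> x; split; case.
move=> Q [incl [lett [B [[inclM incl_inj malB noinvB surj]]]]].
move=> [B_incl lett_bar _ B_lett free].
exists Q, incl, B; split; split=> //.
- by move=> g; rewrite B_incl op_stab.
- move=> v nAv.
  have [AM AV] := (malnormalM malA, malnormalV malA).
  have incl1 : incl 1 = 1 by apply: (@mulgI _ (incl 1)); rewrite -inclM !mulg1.
  have inclV h : incl h^-1 = (incl h)^-1.
    by apply/esym/mulg1_eq; rewrite -inclM mulgV incl1.
  have BA h : A h -> B (incl h) by move=> Ah; apply/B_incl/op_stab.
  have tK : incl t * incl t = 1.
    by rewrite -inclM tt incl1.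
  have [tv|ntv] := EM (coset_equiv t v).
    have tV : t^-1 = t by apply: mulg1_eq.
    case: tv => a [b [Aa Ab Ev]]; have {}Ev : v = a * t * b by rewrite tV in Ev; case: Ev.
    exists (incl b); split; first exact: BA.
    rewrite -inclV -!inclM; apply: BA.
    by rewrite Ev !invgM !mulgA mulgK mulgV mul1g; apply: AV.
  have [vw rv _] := rP v; set w := r v in vw rv.
  have Iw : I w.
    split; last by rewrite -/w -rv.
    + case: vw => a [b [Aa Ab Ew]] Aw; apply: nAv; move: Aw.
      case: Ew => ->; first by rewrite malnormalMr // malnormalMl.
      by rewrite malnormalMr // malnormalMl // => /AV; rewrite invgK.
    + by move=> tw; apply: ntv; apply: coset_equiv_trans tw (coset_equiv_sym vw).
  pose l : G * bool := (w, false).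
  have Bl : B (lett l).
    have := B_lett l 1 1; rewrite incl1 mul1g divg1; apply; rewrite op1 //.
    by split=> //; left.
  have Bt : B (incl t * lett l / incl w).
    apply: B_lett; first by split=> //; right.
    by rewrite phiu.
  have [BM BV] := (malnormalM malB, malnormalV malB).
  case: vw => a [b [Aa Ab [Ew|Ew]]].
    exists (lett l * incl b^-1); split; first exact/BM/BA/AV.
    have -> : v = a^-1 * w * b^-1 by rewrite Ew !mulgA mulVg mul1g mulgK.
    rewrite (_ : _ / _ = incl t * lett l / incl w * incl a); last first.
      by rewrite !inclM !inclV !invgM !invgK !mulgA mulgVK.
    exact/BM/BA.
  have -> : v = b * w^-1 * a.
    by rewrite Ew !invgM !invgK !mulgA mulgV mul1g mulgVK.
  (* [t l w^-1] fixes [x0] and sends [x0 t] to [x0 w^-1] *)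
  exists (incl t * lett l / incl w * incl a); split; first exact/BM/BA.
  rewrite (_ : _ / _ = lett l * incl b^-1); first exact/BM/BA/AV.
  by rewrite !inclM !inclV !invgM !invgK !mulgA tK mul1g mulgK mulgVK.
- by move=> n /free; exists (lett (1, false)).
Qed.
End MovePairs.

(** * Direct limits of groups *)

Section DirectLimit.
Variables (H : nat -> groupType) (f : forall n, H n -> H n.+1).
Hypothesis fM : forall n, {morph @f n : x y / x * y}.
Hypothesis f_inj : forall n, injective (@f n).

Let f1 n : f (1 : H n) = 1.
Proof. by apply: (@mulgI _ (f 1)); rewrite -fM !mulg1. Qed.

Let fV n (x : H n) : f x^-1 = (f x)^-1.
Proof. by apply/esym/mulg1_eq; rewrite -fM mulgV f1. Qed.

(** Deciding [n = m] is what allows an element of [H n] to start a sequence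
    indexed by all levels; [y] continues it at the levels other than [n]. *)
Definition cast_or n m (x : H n) (y : H m) : H m :=
  if n =P m is ReflectT e then eq_rect n (fun k => H k : Type) x m e else y.

Lemma cast_or_id n (x y : H n) : cast_or x y = x.
Proof. by rewrite /cast_or; case: eqP => // e; rewrite (eq_axiomK e). Qed.

Lemma cast_or_neq n m (x : H n) (y : H m) : n <> m -> cast_or x y = y.
Proof. by rewrite /cast_or; case: eqP. Qed.

(** The images of [x] in the later groups; the value [1] in the earlier ones
    is arbitrary, as only the eventual values matter. *)
Fixpoint thread n (x : H n) m : H m :=
  match m with
  | 0 => cast_or x 1
  | m'.+1 => cast_or x (f (thread x m'))
  end.

Lemma thread_id n (x : H n) : thread x n = x.
Proof. by case: n x => [|n] x; rewrite /= cast_or_id. Qed.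

Lemma threadS n (x : H n) m : n <= m -> thread x m.+1 = f (thread x m).
Proof. by move=> nm; rewrite [LHS]/= cast_or_neq // => E; rewrite E ltnn in nm. Qed.

Lemma thread_unique n (s : forall m, H m) :
  (forall m, n <= m -> s m.+1 = f (s m)) ->
  forall m, n <= m -> s m = thread (s n) m.
Proof.
move=> sS; elim=> [|m IH]; first by rewrite leqn0 => /eqP E; subst n; rewrite thread_id.
rewrite leq_eqVlt => /orP[/eqP E|nm]; first by subst n; rewrite thread_id.
by rewrite threadS // sS // IH.
Qed.

Lemma thread_inj n (x y : H n) m : n <= m -> thread x m = thread y m -> x = y.
Proof.
elim: m => [|m IH]; first by rewrite leqn0 => /eqP E; subst n; rewrite !thread_id.
rewrite leq_eqVlt => /orP[/eqP E|nm]; first by subst n; rewrite !thread_id.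
by rewrite !threadS // => /f_inj; apply: IH.
Qed.

Let coherent (s : forall m, H m) := exists n, forall m, n <= m -> s m.+1 = f (s m).

Let coherent_thread n (x : H n) : coherent (thread x).
Proof. by exists n => m; apply: threadS. Qed.

Let coherent1 : coherent (fun=> 1).
Proof. by exists 0 => m _; rewrite f1. Qed.

Let coherentV s : coherent s -> coherent (fun m => (s m)^-1).
Proof. by move=> [n sS]; exists n => m /sS ->; rewrite fV. Qed.

Let coherentM s s' : coherent s -> coherent s' -> coherent (fun m => s m * s' m).
Proof.
move=> [n sS] [n' sS']; exists (maxn n n') => m; rewrite geq_max => /andP[nm nm'].
by rewrite sS // sS' // fM.
Qed.

Let seqs := {s : forall m, H m | coherent s}.
Let eventually_eq (s s' : seqs) :=
  exists n, forall m, n <= m -> sval s m = sval s' m.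

(** The limit is formed by the sequences that are eventually
    compatible with the maps [f], up to eventual equality.  The operations are
    pointwise, so elements of different levels need not be brought to a common level. *)
Theorem direct_limit : exists (Q : groupType) (j : forall n, H n -> Q),
  [/\ forall n, {morph @j n : x y / x * y}, forall n, injective (@j n),
      forall n x, j n.+1 (f x) = j n x & forall q, exists n x, q = j n x].
Proof.
have [] := @quotient_group seqs eventually_eq (exist _ _ coherent1)
  (fun s => exist _ _ (coherentV (svalP s)))
  (fun s s' => exist _ _ (coherentM (svalP s) (svalP s'))).
- by move=> s; exists 0.
- by move=> s s' [n E]; exists n => m /E.
- move=> s1 s2 s3 [n E] [n' E']; exists (maxn n n') => m.
  by rewrite geq_max => /andP[/E -> /E'].
- move=> s1 s2 s3 s4 [n E] [n' E']; exists (maxn n n') => m.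
  by rewrite geq_max /= => /andP[/E -> /E' ->].
- by move=> s1 s2 s3; exists 0 => m _ /=; rewrite mulgA.
- by move=> s; split; exists 0 => m _ /=; rewrite ?mul1g ?mulg1.
- by move=> s; split; exists 0 => m _ /=; rewrite ?mulVg ?mulgV.
move=> Q [pi [pi_surj piE piM]].
exists Q, (fun n x => pi (exist _ _ (coherent_thread x))); split.
- move=> n x y; rewrite -piM; apply/piE; exists n => m nm /=.
  have sS k : n <= k -> thread x k.+1 * thread y k.+1 = f (thread x k * thread y k).
    by move=> nk; rewrite !threadS // fM.
  by rewrite (thread_unique sS nm) !thread_id.
- move=> n x y /piE[k E]; apply: (@thread_inj _ _ _ (maxn n k)).
    exact: leq_maxl.
  by apply: E; apply: leq_maxr.
- move=> n x; apply/piE; exists n.+1 => m nm /=.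
  have sS k : n.+1 <= k -> thread x k.+1 = f (thread x k).
    by move=> /ltnW; apply: threadS.
  by rewrite (thread_unique sS nm) threadS // thread_id.
- move=> q; have [s <-] := pi_surj q; have [n sS] := svalP s.
  by exists n, (sval s n); apply/piE; exists n => m /(thread_unique sS).
Qed.

End DirectLimit.

(** * Sharply 2-transitive coset actions *)

Section Sharp.
Variables (G : groupType) (A : set G).
Hypothesis malA : malnormal A.

(** The hypothesis reaches every pair from [(A, A t)]; an element fixing both
    members of a pair is trivial by malnormality. *)
Lemma coset_sharply_2_transitive (t : G) :
    (forall u, ~ A u -> exists f, A f /\ A (t * f / u)) ->
  sharply_2_transitive (coset_action A).
Proof.
move=> move_pair.
have re := rcoset_eq malA.
have [AM AV] := (malnormalM malA, malnormalV malA).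
split=> [_ _ [g _ <-] [h _ <-]|].
  by exists (g^-1 * h); rewrite /= -rcosetM mulgA mulgV mul1g.
have to_pair g h : rcoset A g <> rcoset A h ->
    exists k, rcoset A k = rcoset A g /\ rcoset A (t * k) = rcoset A h.
  move=> ne; have /move_pair[f [Af Atf]] : ~ A (h / g).
    by move/re => E; apply: ne; rewrite E.
  exists (f * g); split; apply/re; first by rewrite mulgK.
  by move: Atf; rewrite invgM invgK !mulgA.
move=> _ _ _ _ [g1 _ <-] [g2 _ <-] [h1 _ <-] [h2 _ <-] ne ne'.
have [k [k1 k2]] := to_pair _ _ ne; have [l [l1 l2]] := to_pair _ _ ne'.
exists (k^-1 * l); split=> [|m [/= E1 E2]].
  by rewrite /= -k1 -k2 -!rcosetM !mulgA ?mulgK mulgV mul1g.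
apply/esym; rewrite -[m](mulKg k); congr (_ * _); apply: divg1_eq.
have {E1} A1 : A (k * m / l) by apply/re; rewrite rcosetM k1 l1.
have {E2} A2 : A ((k * m / l) ^ t^-1).
  rewrite conjgE invgK !mulgA -(mulgA t k m) -(mulgA t (k * m)).
  have /re : rcoset A (t * k * m) = rcoset A (t * l) by rewrite rcosetM k2 l2.
  by rewrite invgM !mulgA.
apply: (malnormalJ malA _ A1 A2) => /AV; rewrite invgK => At.
apply: ne; rewrite -k1 -k2; apply/esym/re.
by rewrite mulgK.
Qed.

Lemma coset_perm_char_2 :
  (forall t, A t -> ~ involution t) -> perm_char_2 (coset_action A).
Proof.
move=> noinv t [t1 tt] _ [g _ <-] /=; rewrite -rcosetM => /(rcoset_eq malA) Agt.
apply: (noinv (t ^ g^-1)); first by rewrite conjgE invgK mulgA.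
by split; [move/eqP; rewrite conjg_eq1 => /eqP|rewrite -conjXg tt conj1g].
Qed.

End Sharp.

(** * Cardinal arithmetic *)

Definition embeds (T U : Type) : Prop := exists h : T -> U, injective h.

Lemma embeds_trans T U V : embeds T U -> embeds U V -> embeds T V.
Proof. by move=> [h hI] [k kI]; exists (k \o h); apply: inj_comp. Qed.

Lemma embeds_card_le (T U : Type) (B : set U) (h : T -> U) :
  injective h -> (forall x, B (h x)) -> [set: T] #<= B.
Proof.
move=> hI hB.
have /injfunPex[k] : exists2 k : T -> U, set_fun [set: T] B k & set_inj [set: T] k.
  by exists h => // x y _ _ /hI.
exact: inj_card_le.
Qed.

Lemma infinite_embeds_nat (T : Type) : infinite_set [set: T] -> embeds nat T.
Proof.
move=> infT; have [x0 _] := infinite_setN0 infT.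
pose CT : choiceType := HB.pack T (gen_eqMixin T) (gen_choiceMixin T).
pose PT : pointedType := HB.pack CT (isPointed.Build CT x0).
have : ([set: nat] #<= [set: PT]) by apply/infiniteP.
move=> /pcard_injP[h hI]; exists h => m n; apply: hI; exact: mem_set.
Qed.

(** Comparability of cardinals: a maximal partial injection from [A] to [B]
    is defined on all of [A] or reaches all of [B]. *)
Lemma partial_injection_total (T : Type) (A B : set T) :
  (exists h : T -> T, set_inj A h /\ forall x, A x -> B (h x)) \/
  (exists h : T -> T, set_inj B h /\ forall y, B y -> A (h y)).
Proof.
pose P (F : set (T * T)) := [/\ forall x y, F (x, y) -> A x /\ B y,
  forall x y y', F (x, y) -> F (x, y') -> y = y'
  & forall x x' y, F (x, y) -> F (x', y) -> x = x'].
have [C CP Ctot|F [[FAB Ff Fi] Fmax]] := @Zorn_bigcup _ P.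
  have both p q : (\bigcup_(X in C) X) p -> (\bigcup_(X in C) X) q ->
      exists X, [/\ C X, X p & X q].
    move=> [X CX Xp] [Y CY Yq]; case: (Ctot X Y CX CY) => s.
      by exists Y; split=> //; apply: s.
    by exists X; split=> //; apply: s.
  split=> [x y [X CX /= Xxy]|x y y' h h'|x x' y h h'].
  - by have [H _ _] := CP X CX; apply: H.
  - by have [X [CX X1 X2]] := both _ _ h h'; have [_ H _] := CP X CX; apply: H X1 X2.
  - by have [X [CX X1 X2]] := both _ _ h h'; have [_ _ H] := CP X CX; apply: H X1 X2.
have [Atot|] := EM (forall x, A x -> exists y, F (x, y)).
  left; pose h x := if pselect (exists y, F (x, y)) is left e then sval (cid e) else x.
  have hP x : A x -> F (x, h x).
    by move=> /Atot e; rewrite /h; case: pselect => // e'; case: cid.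
  exists h; split=> [x y|x /hP /FAB[] //].
  by rewrite !inE => /hP Fx /hP Fy E; apply: Fi Fx _; rewrite E.
move=> /existsNP[a /not_implyP[Aa /forallNP na]].
have [Btot|] := EM (forall y, B y -> exists x, F (x, y)).
  right; pose h y := if pselect (exists x, F (x, y)) is left e then sval (cid e) else y.
  have hP y : B y -> F (h y, y).
    by move=> /Btot e; rewrite /h; case: pselect => // e'; case: cid.
  exists h; split=> [x y|x /hP /FAB[] //].
  by rewrite !inE => /hP Fx /hP Fy E; apply: Ff Fx _; rewrite E.
move=> /existsNP[b /not_implyP[Bb /forallNP nb]].
case: (Fmax (F `|` [set (a, b)])).
  split; first by move=> p Fp; left.
  by move=> s; apply: (na b); apply: s; right.
split=> [x y [/FAB //|[-> ->] //]|x y y'|x x' y].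
- move=> [Fy|[xa yb]] [Fy'|E]; first exact: Ff Fy Fy'.
  + by case: E => xa _; case: (na y); rewrite -xa.
  + by case: (na y'); rewrite -xa.
  + by case: E => _ ->.
- move=> [Fy|[xa yb]] [Fy'|E]; first exact: Fi Fy Fy'.
  + by case: E => _ yb; case: (nb x); rewrite -yb.
  + by case: (nb x'); rewrite -yb.
  + by case: E => ->.
Qed.

(** Zorn's lemma gives a subset [Z] with a maximal injection [m] from [Z * Z] to
    [Z], extending a pairing of a countable set.  If the complement of
    [Z] embeds in [Z], then [T] embeds in [Z * Z] and so in [Z], and [m] does
    the rest.  Otherwise the complement contains a copy [Z'] of [Z]; the pairs of
    elements of [Z] and [Z'] that are not in [Z * Z] form three copies of
    [Z * Z], which embed in [Z'], and [m] is not maximal.  Partial maps are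
    represented by their graphs [F]; [dom F] is the set of diagonal arguments. *)
Lemma infinite_square (T : Type) : infinite_set [set: T] -> embeds (T * T) T.
Proof.
move=> /infinite_embeds_nat[e e_inj].
pose dom (F : set ((T * T) * T)) x := exists z, F ((x, x), z).
pose F0 : set ((T * T) * T) :=
  [set q | exists i j, q = ((e i, e j), e (pickle (i, j)))].
pose P (F : set ((T * T) * T)) := [/\ forall x y z, F ((x, y), z) -> [/\ dom F x, dom F y & dom F z],
  forall x y, dom F x -> dom F y -> exists z, F ((x, y), z),
  forall p z z', F (p, z) -> F (p, z') -> z = z'
  & forall p p' z, F (p, z) -> F (p', z) -> p = p'].
have dom0 i : dom F0 (e i) by exists (e (pickle (i, i))), i, i.
have P0 : P F0.
  split.
  - by move=> x y z [i [j [-> -> ->]]]; split; apply: dom0.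
  - move=> x y [_ [i [_ [-> _ _]]]] [_ [j [_ [-> _ _]]]].
    by exists (e (pickle (i, j))), i, j.
  - by move=> p z z' [i [j [-> ->]]] [i' [j' [/e_inj -> /e_inj -> ->]]].
  - by move=> p p' z [i [j [-> ->]]] [i' [j' [-> /e_inj /(pcan_inj pickleK)[-> ->]]]].
(* the alternative [F = set0] accounts for the union of the empty chain *)
have [C CP Ctot|F [[-> |[F0F PF]] Fmax]] :=
  @Zorn_bigcup _ (fun F => F = set0 \/ F0 `<=` F /\ P F).
- have [C0|] := EM (exists2 X, C X & X <> set0); last first.
    move=> nC; left; apply/seteqP; split=> // p [X CX Xp].
    by exfalso; apply: nC; exists X => // X0; rewrite X0 in Xp.
  right; have [X0 CX0 nX0] := C0.
  split.
    case: (CP X0 CX0) => [//|[F0X _]] p /F0X Xp; by exists X0.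
  have CP' p X : C X -> X p -> P X.
    by move=> CX Xp; case: (CP X CX) => [E|[]//]; rewrite E in Xp.
  have both p q : (\bigcup_(X in C) X) p -> (\bigcup_(X in C) X) q ->
      exists X, [/\ C X, X p, X q & P X].
    move=> [X CX Xp] [Y CY Yq]; case: (Ctot X Y CX CY) => s.
      by exists Y; split=> //; [apply: s|apply: CP' CY Yq].
    by exists X; split=> //; [apply: s|apply: CP' CX Xp].
  split.
  - move=> x y z h; have [X [CX Xp _ [PX _ _ _]]] := both _ _ h h.
    have [[a Xa] [b Xb] [c Xc]] := PX _ _ _ Xp.
    by split; [exists a|exists b|exists c]; exists X.
  - move=> x y [a ha] [b hb]; have [X [CX Xa Xb [_ PX _ _]]] := both _ _ ha hb.
    by have [z Xz] := PX x y (ex_intro _ a Xa) (ex_intro _ b Xb); exists z, X.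
  - move=> p z z' h h'; have [X [CX Xa Xb [_ _ PX _]]] := both _ _ h h'.
    exact: PX Xa Xb.
  - move=> p p' z h h'; have [X [CX Xa Xb [_ _ _ PX]]] := both _ _ h h'.
    exact: PX Xa Xb.
- exfalso; apply: (Fmax F0); last by right; split.
  split=> [//|s]; have : F0 ((e 0, e 0), e (pickle (0, 0))) by exists 0, 0.
  by move/s.
have [Fdom Ftot Ff Fi] := PF; set Z := dom F in Fdom Ftot.
have Ze i : Z (e i) by have [z /F0F Fz] := dom0 i; exists z.
pose m x y := if pselect (exists z, F ((x, y), z)) is left h then sval (cid h) else x.
have mP x y : Z x -> Z y -> F ((x, y), m x y).
  by move=> Zx Zy; rewrite /m; case: pselect => [h|[]]; [case: cid|apply: Ftot].
have Zm x y : Z x -> Z y -> Z (m x y).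
  by move=> Zx Zy; have [] := Fdom _ _ _ (mP _ _ Zx Zy).
have m_inj x y x' y' : Z x -> Z y -> Z x' -> Z y' ->
    m x y = m x' y' -> x = x' /\ y = y'.
  move=> Zx Zy Zx' Zy' E; have := mP _ _ Zx' Zy'; rewrite -E => F'.
  by have [-> ->] := Fi _ _ _ (mP _ _ Zx Zy) F'.
have [[h [hI hZ]]|[h [hI hZ]]] := partial_injection_total (~` Z) Z.
  pose d x := if pselect (Z x) then m (e 0) x else m (e 1%N) (h x).
  have Zd x : Z (d x).
    by rewrite /d; case: pselect => [Zx|nZx]; apply: (Zm) => //; apply: hZ.
  have d_inj : injective d.
    move=> x y; rewrite /d.
    case: pselect => Zx; case: pselect => Zy /m_inj[] //; auto.
    - by move/e_inj.
    - by move/e_inj.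
    - by move=> _; apply: hI; apply: mem_set.
  exists (fun p => m (d p.1) (d p.2)) => -[x y] [x' y'] /= /m_inj[] //.
  by move=> /d_inj -> /d_inj ->.
exfalso.
pose Z' x := exists2 y, Z y & x = h y.
have Z'N x : Z' x -> ~ Z x by move=> [y /hZ ? ->].
have hI' x y : Z x -> Z y -> h x = h y -> x = y.
  by move=> Zx Zy; apply: hI; apply: mem_set.
have dZ' x : exists y, Z' x -> Z y /\ x = h y.
  by have [[y Zy E]|nZ'] := EM (Z' x); [exists y|exists x].
(* [d] identifies [Z'] with [Z]; [tag] tells the three kinds of new pairs apart *)
pose d x := if pselect (Z x) then x else sval (cid (dZ' x)).
have Zd x : Z x \/ Z' x -> Z (d x).
  rewrite /d; case: pselect => // nZ [//|Z'x].
  by case: cid => y /= /(_ Z'x)[].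
have dE x y : Z x \/ Z' x -> Z y \/ Z' y -> (Z x <-> Z y) -> d x = d y -> x = y.
  rewrite /d; case: pselect => Zx; case: pselect => Zy hx hy iff //; try by exfalso; tauto.
  case: cid => a /= [|_ ->]; first by case: hx.
  case: cid => b /= [|_ ->]; first by case: hy.
  by move=> ->.
pose tag x y := e (if pselect (Z x) then 0%N else if pselect (Z y) then 1%N else 2%N).
pose k x y := h (m (tag x y) (m (d x) (d y))).
pose F1 : set ((T * T) * T) := [set q | exists x y, [/\ Z x \/ Z' x, Z y \/ Z' y,
   ~ (Z x /\ Z y) & q = ((x, y), k x y)]].
have kZ' x y : Z x \/ Z' x -> Z y \/ Z' y -> Z' (k x y).
  move=> hx hy; exists (m (tag x y) (m (d x) (d y))) => //.
  by apply: (Zm); [apply: Ze|apply: (Zm); apply: (Zd)].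
have domU x : dom (F `|` F1) x <-> Z x \/ Z' x.
  split=> [[z [Fx|[y [_ [h1 _ _ [-> _ _]]]]]]|]; last 1 first.
  - have [Zx|nZx] := EM (Z x); first by move=> _; have [z Fz] := Zx; exists z; left.
    by move=> hx; exists (k x x); right; exists x, x; split=> // -[].
  - by left; exists z.
  - exact: h1.
case: (Fmax (F `|` F1)).
  split; first by move=> p; left.
  move=> s; have Z'h : Z' (h (e 0)) by exists (e 0).
  have := Z'N _ Z'h; apply.
  have Fh : F ((h (e 0), h (e 0)), k (h (e 0)) (h (e 0))).
    apply: s; right; exists (h (e 0)), (h (e 0)); split; [by right|by right| |by []].
    by move=> [/(Z'N _ Z'h)].
  by have [] := Fdom _ _ _ Fh.
right; split; first by move=> p /F0F; left.
split.
- move=> x y z [/Fdom[Zx Zy Zz]|[x' [y' [hx hy _ [-> -> ->]]]]].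
    by split; apply/domU; left.
  by split; apply/domU => //; right; apply: kZ'.
- move=> x y /domU hx /domU hy; have [[Zx Zy]|nZ] := EM (Z x /\ Z y).
    by exists (m x y); left; apply: mP.
  by exists (k x y); right; exists x, y.
- move=> p z z' [Fz|[x [y [hx hy nZ [-> ->]]]]] [Fz'|[x' [y' [hx' hy' nZ' E]]]].
  + exact: Ff Fz Fz'.
  + by case: E => E _; rewrite E in Fz; have [? ? _] := Fdom _ _ _ Fz; case: nZ'.
  + by have [? ? _] := Fdom _ _ _ Fz'; case: nZ.
  + by case: E => -> -> ->.
- move=> p p' z [Fz|[x [y [hx hy nZ [-> ->]]]]] [Fz'|[x' [y' [hx' hy' nZ' [E E']]]]].
  + exact: Fi Fz Fz'.
  + case: p Fz => a b Fz; have [_ _] := Fdom _ _ _ Fz.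
    by rewrite E' => /(Z'N _ (kZ' _ _ hx' hy')).
  + case: p' Fz' => a b Fz'; have [_ _] := Fdom _ _ _ Fz'.
    by move=> /(Z'N _ (kZ' _ _ hx hy)).
  + have ZZ u v : Z u \/ Z' u -> Z v \/ Z' v -> Z (m (d u) (d v)).
      by move=> hu hv; apply: (Zm); apply: (Zd).
    have Zt u v : Z (tag u v) by apply: Ze.
    have [Z1 Z2] := (ZZ _ _ hx hy, ZZ _ _ hx' hy').
    rewrite E; move: E' => /(hI' _ _ (Zm _ _ (Zt _ _) Z1) (Zm _ _ (Zt _ _) Z2)).
    move=> /(m_inj _ _ _ _ (Zt _ _) Z1 (Zt _ _) Z2)[/e_inj Et].
    move=> /(m_inj _ _ _ _ (Zd _ hx) (Zd _ hy) (Zd _ hx') (Zd _ hy'))[Ex Ey].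
    have iffx : Z x <-> Z x'.
      move: Et; case: (pselect (Z x)) => Zx; case: (pselect (Z x')) => Zx';
        try tauto; by case: (pselect (Z y)); case: (pselect (Z y')).
    have iffy : Z y <-> Z y'.
      move: Et; case: (pselect (Z x)) => Zx; case: (pselect (Z x')) => Zx'; try tauto.
      by case: (pselect (Z y)) => Zy; case: (pselect (Z y')) => Zy' //; tauto.
    by rewrite (dE x x') // (dE y y').
Qed.

Section Embeds.
Variable U : Type.
Hypothesis infU : infinite_set [set: U].

Lemma embeds_refl : embeds U U.
Proof. by exists id. Qed.

Lemma embeds_count (T : countType) : embeds T U.
Proof.
apply: embeds_trans (infinite_embeds_nat infU).
by exists pickle; apply: pcan_inj pickleK.
Qed.

Lemma embeds_prod (T T' : Type) :
  embeds T U -> embeds T' U -> embeds (T * T') U.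
Proof.
move=> [h hI] [h' hI']; apply: embeds_trans (infinite_square infU).
by exists (fun p => (h p.1, h' p.2)) => -[x y] [x' y'] /= [/hI -> /hI' ->].
Qed.

Lemma embeds_sigT (T : nat -> Type) :
  (forall n, embeds (T n) U) -> embeds {n & T n} U.
Proof.
move=> /(_ _) /cid; move=> h.
apply: embeds_trans (embeds_prod (embeds_count nat) embeds_refl).
exists (fun s => (tag s, sval (h (tag s)) (tagged s))).
move=> [n x] [m y] /= [E]; subst m.
by move=> /(svalP (h n)) ->.
Qed.

Lemma embeds_sum (T T' : Type) :
  embeds T U -> embeds T' U -> embeds (T + T') U.
Proof.
move=> [h hI] [h' hI'].
apply: embeds_trans (embeds_prod (embeds_count bool) embeds_refl).
exists (fun s => match s with inl x => (true, h x) | inr y => (false, h' y) end).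
by move=> [x|y] [x'|y'] // [] => [/hI ->|/hI' ->].
Qed.

Lemma embeds_seq (T : Type) : embeds T U -> embeds (seq T) U.
Proof.
move=> TU; have [x0 _] := infinite_setN0 infU.
have powU n : embeds (n.-tuple T) U.
  elim: n => [|n IH].
    by exists (fun=> x0) => s s' _; rewrite (tuple0 s) (tuple0 s').
  apply: embeds_trans (embeds_prod TU IH).
  exists (fun s => (thead s, [tuple of behead s])) => s s' [E1 E2].
  by rewrite (tuple_eta s) (tuple_eta s'); apply: val_inj; rewrite /= E1 E2.
apply: embeds_trans (embeds_sigT powU).
exists (fun s => existT (fun n => n.-tuple T) (size s) (in_tuple s)).
by move=> s s' /(congr1 (fun u : {n & n.-tuple T} => tval (tagged u))).
Qed.

Lemma embeds_surj (T T' : Type) (f : T -> T') :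
  (forall y, exists x, f x = y) -> embeds T U -> embeds T' U.
Proof.
move=> f_surj; apply: embeds_trans.
exists (fun y => sval (cid (f_surj y))) => y y'.
by case: cid => x /= <-; case: cid => x' /= <- ->.
Qed.

End Embeds.

Lemma finite_embeds (T U : Type) :
  embeds T U -> finite_set [set: U] -> finite_set [set: T].
Proof.
by move=> [h hI]; apply: card_le_finite; apply: embeds_card_le hI _.
Qed.

(** For [g0] outside [A], malnormality makes [a |-> A g0 a] injective on [A], so
    there are at least as many cosets as elements of [A], and [G] embeds in
    pairs of cosets. *)
Lemma card_rcosets (G : groupType) (A : set G) : malnormal A ->
  infinite_set [set: G] -> rcosets A #= [set: G].
Proof.
move=> malA infG; rewrite card_eq_le; apply/andP; split.
  exact: card_image_le.
have [A1 AV] := (malnormal1 malA, malnormalV malA).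
pose K := {C | rcosets A C}.
pose coset (g : G) : K := exist _ (rcoset A g) (ex_intro2 _ _ g I erefl).
have coset_eq g h : coset g = coset h <-> A (g / h).
  by rewrite -(rcoset_eq malA); split=> [[]|E] //; apply: eq_exist.
have [g0 nAg0] : exists g0, ~ A g0.
  apply: contrapT => /forallNP nA; have [_ AT _] := malA; apply: AT.
  by apply/seteqP; split=> // g _; apply: contrapT.
have [r rP] : exists r : G -> G, forall g, A (g / r g) /\
    forall h, coset g = coset h -> r g = r h.
  have [] := @class_representatives G (fun g h => coset g = coset h) => //.
    by move=> x y z ->.
  by move=> r rP; exists r => g; have [/coset_eq] := rP g.
have GKK : embeds G (K * K).
  exists (fun g => (coset (g0 * (g / r g)), coset g)) => g h [].
  move=> E1 E2; have /coset_eq {}E1 : coset (g0 * (g / r g)) = coset (g0 * (h / r h)).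
    exact: eq_exist.
  have {}E2 : coset g = coset h by apply: eq_exist.
  have /coset_eq Agh := E2.
  have [Ag /(_ _ E2) rgh] := rP g; rewrite rgh in E1 *.
  apply: divg1_eq; apply: (malnormalJ malA (g := g0^-1)) => //.
    by move/AV; rewrite invgK.
  rewrite conjgE invgK; move: E1.
  by rewrite !invgM !invgK !mulgA mulgVK.
have infK : infinite_set [set: K].
  move=> finK; apply: infG; apply: finite_embeds GKK _.
  rewrite (_ : [set: K * K] = [set: K] `*` [set: K]); first exact: finite_setX.
  by apply/seteqP; split.
have [h hI] := embeds_trans GKK (infinite_square infK).
apply: (@embeds_card_le _ _ _ (sval \o h)).
  by apply: inj_comp => // -[C HC] [C' HC'] /= E; apply: eq_exist.
by move=> g /=; apply: svalP.
Qed.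

(** * The tower of extensions *)

Record stage := Stage {
  carrier :> groupType;
  stab : set carrier;
  tau : carrier;
  stab_malnormal : malnormal stab;
  stab_noinv : forall g, stab g -> ~ involution g;
  tau_involution : involution tau
}.

(** [ext_pair] provides, for every pair of cosets of the stage [S], an element
    of the next stage sending the central pair to it; [ext_free] excludes abelian
    normal subgroups in the limit. *)
Record extension (S S' : stage) := Extension {
  ext :> S -> S';
  extM : {morph ext : g h / g * h};
  ext_inj : injective ext;
  ext_stab : forall g, stab (ext g) <-> stab g;
  ext_tau : ext (tau S) = tau S';
  ext_pair : forall u, ~ stab u -> exists f : S', stab f /\ stab (tau S' * f / ext u);
  ext_free : forall n, n <> 1 -> exists d, ~ commute (ext n) (ext n ^ d);
  ext_card : exists pi : seq (S + S * bool) -> S', forall q, exists w, pi w = q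
}.

Lemma stage_extension (S : stage) : exists S' : stage, $|extension S S'|.
Proof.
have [tt t1] := tau_involution S.
have [Q [i [B [[iM i_inj malB noinvB] [i_sub i_pair i_free surj]]]]] :=
  move_pairs (@stab_malnormal S) (@stab_noinv S) (tau_involution S).
have i1 : i 1 = 1 by apply: (@mulgI _ (i 1)); rewrite -iM !mulg1.
have inv_t : involution (i (tau S)).
  split; first by rewrite -i1 => /i_inj.
  by move: t1; rewrite !(expgS, expg0, mulg1) -iM => ->.
pose S' := Stage malB noinvB inv_t.
by exists S'; squash (@Extension S S' i iM i_inj i_sub erefl i_pair i_free surj).
Qed.

Lemma stage_tower (S : stage) : exists T : nat -> stage,
  T 0 = S /\ forall n, $|extension (T n) (T n.+1)|.
Proof.
pose next S := sval (cid (stage_extension S)).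
exists (fun n => iter n next S); split=> // n.
by rewrite iterS /next; case: cid.
Qed.

Lemma no_abelian_normal (G : groupType) :
    (forall n : G, n <> 1 -> exists d, ~ commute n (n ^ d)) ->
  ~ exists N : set G, [/\ normal N, abelian N & N <> [set 1]].
Proof.
move=> free [N [[/subgroupP[N1 _ _] NJ] abN]]; apply.
apply/seteqP; split=> [n Nn|_ ->] //=; apply: contrapT => /free[d]; apply.
by apply: abN => //; apply: NJ.
Qed.

Lemma card_eq_embeds (T U : Type) :
  embeds T U -> embeds U T -> [set: T] #= [set: U].
Proof.
move=> [h hI] [k kI]; rewrite card_eq_le.
by apply/andP; split; [exact: embeds_card_le hI _|exact: embeds_card_le kI _].
Qed.

Theorem theorem1p3 (G : groupType) (A : set G)
    (malA : malnormal A)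
    (invA : forall t, A t -> ~ involution t)
    (not_s2tA : ~ sharply_2_transitive (coset_action A)) :
  exists (GG : groupType) (iota : {multiplicative G -> GG}) (AA : set GG),
    [/\ injective iota, malnormal AA
      & [/\ AA `&` range iota = iota @` A,
            sharply_2_transitive (coset_action AA),
            (forall t, AA t -> ~ involution t) /\ perm_char_2 (coset_action AA),
            ~ (exists N : set GG, [/\ normal N, abelian N & N <> [set 1]])
          & infinite_set [set: G] ->
            ([set: G] #= [set: GG]) /\ (rcosets AA #= rcosets A)]].
Proof.
have [G0 [i [B [t [[iM i_inj malB noinvB inv_t] [i_sub [pi0 surj0]]]]]]] :=
  adjoin_involution malA invA.
pose S0 := Stage malB noinvB inv_t.
have [T [T0 Text]] := stage_tower S0.
have [i0 [i0M i0_inj i0_sub [pi surj]]] : exists i0 : G -> T 0,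
    [/\ {morph i0 : g h / g * h}, injective i0, forall g, stab (i0 g) <-> A g
      & exists pi : seq (G + option bool) -> T 0, forall q, exists w, pi w = q].
  by rewrite T0; exists i; split=> //; exists pi0.
have {Text} f n : extension (T n) (T n.+1) by apply: unsquash (Text n).
have [Q [j [jM j_inj jf j_surj]]] :=
  direct_limit (fun n => @extM _ _ (f n)) (fun n => @ext_inj _ _ (f n)).
have j1 n : j n 1 = 1 by apply: (@mulgI _ (j n 1)); rewrite -jM !mulg1.
have jV n x : j n x^-1 = (j n x)^-1.
  by apply/esym/mulg1_eq; rewrite -jM mulgV j1.
have jJ n x y : j n (x ^ y) = j n x ^ j n y by rewrite !conjgE !jM jV.
have lift n m x : n <= m -> exists y, j m y = j n x /\ (stab y <-> stab x).
  elim: m => [|m IH]; first by rewrite leqn0 => /eqP E; subst n; exists x.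
  rewrite leq_eqVlt => /orP[/eqP E|/IH[y [<- Sy]]]; first by subst n; exists x.
  by exists (f m y); split; [apply: jf|apply: iff_trans Sy; apply: ext_stab].
pose AA : set Q := [set q | exists n x, q = j n x /\ stab x].
have AAj n x : AA (j n x) <-> stab x.
  split=> [[m [y [E sy]]]|sx]; last by exists n, x.
  have [x' [Ex Sx']] := lift n (maxn n m) x (leq_maxl _ _).
  have [y' [Ey /iffRL/(_ sy)]] := lift m (maxn n m) y (leq_maxr _ _).
  by move=> Sy'; apply/Sx'; rewrite (j_inj _ x' y') // Ex Ey.
have common p q : exists n x y, p = j n x /\ q = j n y.
  have [n [x ->]] := j_surj p; have [m [y ->]] := j_surj q.
  have [x' [Ex _]] := lift n (maxn n m) x (leq_maxl _ _).
  have [y' [Ey _]] := lift m (maxn n m) y (leq_maxr _ _).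
  by exists (maxn n m), x', y'.
have AA1 : AA 1.
  have /iffRL := AAj 0 1; rewrite j1; apply.
  exact: malnormal1 (@stab_malnormal _).
have malAA : malnormal AA.
  split.
  - apply/subgroupP; split.
    + exact: AA1.
    + move=> p q; have [n [x [y [-> ->]]]] := common p q.
      by rewrite -jM => /AAj Sx /AAj Sy; apply/AAj; apply: malnormalM (@stab_malnormal _) _ _ _ _.
    + move=> p; have [n [x ->]] := j_surj p.
      by rewrite -jV => /AAj Sx; apply/AAj; apply: malnormalV (@stab_malnormal _) _ _.
  - move=> AT; have : AA (j 0 (tau (T 0))) by rewrite AT.
    by move/AAj/stab_noinv; apply; apply: tau_involution.
  - move=> g ng; apply/seteqP; split=> [q [AAq [r AAr Er]]|_ ->]; last first.
      by split=> //; exists 1; rewrite ?conj1g.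
    have [n [x [y [Ex Ey]]]] := common r g; subst r g q.
    move: AAq; rewrite -jJ => /AAj Sxy; move/AAj: AAr => Sx.
    rewrite (malnormalJ (@stab_malnormal _) _ Sx Sxy) ?conj1g ?j1 //.
    by move=> Sy; apply/ng/AAj.
have noinvAA q : AA q -> ~ involution q.
  have [n [x ->]] := j_surj q => /AAj Sx [x1 xx]; apply: (stab_noinv Sx); split.
    by move=> E; apply: x1; rewrite E j1.
  by apply: (j_inj n); rewrite j1 -xx !(expgS, expg0, mulg1) jM.
have jinv n : j n (tau (T n)) = j 0 (tau (T 0)).
  by elim: n => // n <-; rewrite -(ext_tau (f n)) jf.
have pairAA u : ~ AA u -> exists g, AA g /\ AA (j 0 (tau (T 0)) * g / u).
  have [n [x ->]] := j_surj u => nAA.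
  have [y [Sy Sty]] : exists y : T n.+1, stab y /\ stab (tau (T n.+1) * y / f n x).
    by apply: ext_pair => Sx; apply/nAA/AAj.
  by exists (j n.+1 y); split; [apply/AAj|rewrite -(jinv n.+1) -(jf n x) -jV -!jM; apply/AAj].
have freeQ (q : Q) : q <> 1 -> exists d, ~ commute q (q ^ d).
  have [n [x ->]] := j_surj q => x1.
  have [|d nc] := ext_free (f n) (n := x); first by move=> E; apply: x1; rewrite E j1.
  exists (j n.+1 d) => c; apply: nc; apply: (j_inj n.+1).
  by rewrite [LHS]jM [RHS]jM jJ jf.
pose iota0 g := j 0 (i0 g).
have iota_inj : injective iota0 by apply: inj_comp.
have iotaM : {morph iota0 : g h / g * h} by move=> g h; rewrite /iota0 i0M jM.
pose iota : {multiplicative G -> Q} :=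
  HB.pack iota0 (isMultiplicative.Build G Q iota0 iotaM).
exists Q, iota, AA; split=> //; split.
- apply/seteqP; split=> [q [AAq [g _ Eq]]|_ [g Ag <-]].
    by exists g => //; move: AAq; rewrite -Eq => /AAj/i0_sub.
  by split; [apply/AAj/i0_sub|exists g].
- exact: (coset_sharply_2_transitive malAA pairAA).
- by split=> //; apply: coset_perm_char_2.
- exact: no_abelian_normal.
- move=> infG.
  have GQ : embeds G Q by exists iota0.
  have QG : embeds Q G.
    apply: (@embeds_surj _ {n & T n} _ (fun s => j (tag s) (tagged s))).
      by move=> q; have [n [x ->]] := j_surj q; exists (existT _ n x).
    apply: embeds_sigT => //; elim=> [|n IH].
      apply: embeds_surj surj _; apply: embeds_seq => //.
      by apply: embeds_sum => //; [apply: embeds_refl|apply: embeds_count].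
    have [p p_surj] := ext_card (f n).
    apply: embeds_surj p_surj _; apply: embeds_seq => //.
    apply: embeds_sum => //; apply: embeds_prod => //; exact: embeds_count.
  have EGQ := card_eq_embeds GQ QG; split=> //.
  have infQ : infinite_set [set: Q] by move=> /(finite_embeds GQ).
  apply: card_eq_trans (card_rcosets malAA infQ) _.
  apply: card_eq_trans (card_esym EGQ) _.
  exact/card_esym/card_rcosets.
Qed.
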